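(* Let $-1<\lambda\le1$ and let $m,k$ be integers with $\lambda+2m>0$ and $2-\lambda+2k>0$. Let $\pi_1=R_{\lambda,\mu}$ be a representation from the Continuous series excluding $P_{1,0}$, acting on $H_1$, and let $\pi_2=D^+_{\lambda+2m}\oplus D^-_{2-\lambda+2k}$, acting on $H_2=H^{(\lambda+2m)}\oplus H^{(2-\lambda+2k)}$. Suppose $T=\begin{bmatrix}T_1&S_1\\S_2&T_2\end{bmatrix}$ is a homogeneous operator on $H_1\oplus H_2$ with associated representation $\pi_1\oplus\pi_2$. Then $S_1=0$.
   Context: All Hilbert spaces are complex and separable and operators are bounded and linear. Möb is the locally compact group of maps $\phi_{\theta,a}(z)=e^{i\theta}\frac{z-a}{1-\bar a z}$, $\theta\in\mathbb R$, $a\in\mathbb D$. An operator $T$ is homogeneous if its spectrum lies in $\overline{\mathbb D}$ and $\phi(T)$ is unitarily equivalent to $T$ for all $\phi\in$ Möb. A projective unitary representation $\pi$ of Möb is associated with $T$ if $\phi(T)=\pi(\phi)^*T\pi(\phi)$ for all $\phi\in$ Möb. In the block matrix, $S_1:H_2\to H_1$ and $S_2:H_1\to H_2$. Fix for each $\phi=\phi_{\theta,a}$, $\theta\in(-\pi,\pi]$, the branch $\log\phi'(z)=i\theta+\log(1-|a|^2)-2\log(1-\bar az)$ (principal logarithm) and put $\phi'(z)^{\lambda/2}=\exp(\tfrac\lambda2\log\phi'(z))$. $R_{\lambda,\mu}$ is given by $(R_{\lambda,\mu}(\phi^{-1})f)(z)=\phi'(z)^{\lambda/2}|\phi'(z)|^{\mu}f(\phi(z))$.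 Continuous series (functions on $\mathbb T$): the Principal series $P_{\lambda,s}=R_{\lambda,\mu}$, $-1<\lambda\le1$, $s$ purely imaginary, $\mu=\frac{1-\lambda}2+s$, on $L^2(\mathbb T)$ (with $\{z^n\}$ orthonormal); and the Complementary series $C_{\lambda,\sigma}=R_{\lambda,\mu}$, $-1<\lambda<1$, $0<\sigma<\frac12(1-|\lambda|)$, $\mu=\frac{1-\lambda}2+\sigma$, on the Hilbert space with orthogonal basis $\{z^n\}_{n\in\mathbb Z}$ and $\|z^n\|^2=\prod_{k=0}^{|n|-1}\frac{k\pm\frac\lambda2+\frac12-\sigma}{k\pm\frac\lambda2+\frac12+\sigma}$ (sign $+$ for $n\ge0$, $-$ for $n<0$). Discrete series: for $\nu>0$, $D_\nu^+=R_{\nu,0}$ acts on the Hilbert space $H^{(\nu)}$ of holomorphic functions on $\mathbb D$ with orthogonal basis $\{z^n\}_{n\ge0}$, $\|z^n\|^2=\frac{\Gamma(n+1)\Gamma(\nu)}{\Gamma(n+\nu)}$; $D_\nu^-$ acts on the same space $H^{(\nu)}$ by $D_\nu^-(\phi)=D_\nu^+(\phi^* )$, $\phi^*(z)=\overline{\phi(\bar z)}$, the branch being the conjugate one, i.e. $(D^-_\nu(\phi^{-1})f)(z)=\overline{\phi'(\bar z)^{\nu/2}}\,f(\phi^*(z))$. *)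

(* Defs.v *)
From Stdlib Require Export Reals ZArith.
From Stdlib Require Import Lra Lia Psatz.
From Stdlib Require Import Classical ClassicalEpsilon FunctionalExtensionality
  PropExtensionality ProofIrrelevance.
From Coquelicot Require Export Coquelicot.

Open Scope R_scope.

Ltac eq_in T := lazymatch goal with |- @eq _ ?x ?y => change (@eq T x y) end.

Record Hilbert := mkHilbert {
  hspace :> CompleteNormedModule C_AbsRing;
  inner : hspace -> hspace -> C;
  inner_plus_l : forall x y z,
    inner (plus x y) z = Cplus (inner x z) (inner y z);
  inner_scal_l : forall (c : C) x y,
    inner (scal c x) y = Cmult c (inner x y);
  inner_sym : forall x y, inner y x = Cconj (inner x y);
  inner_norm : forall x, inner x x = RtoC (norm x ^ 2)
}.
Arguments inner {h} _ _.

Section CompleteFromLimits.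
Variable T : UniformSpace.
Hypothesis has_lim : forall F : (T -> Prop) -> Prop,
  ProperFilter F -> cauchy F -> exists x, forall eps : posreal, F (ball x eps).
Variable t0 : T.

Definition choice_lim (F : (T -> Prop) -> Prop) : T :=
  epsilon (inhabits t0) (fun x => forall eps : posreal, F (ball x eps)).

Lemma choice_lim_ax1 (F : (T -> Prop) -> Prop) :
  ProperFilter F -> cauchy F ->
  forall eps : posreal, F (ball (choice_lim F) eps).
Proof. intros pF cF; unfold choice_lim; apply epsilon_spec, has_lim; auto. Qed.

Lemma choice_lim_ax2 (F1 F2 : (T -> Prop) -> Prop) :
  filter_le F1 F2 -> filter_le F2 F1 -> close (choice_lim F1) (choice_lim F2).
Proof.
intros h1 h2.
assert (e : F1 = F2).
{ apply functional_extensionality; intros P.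
  apply propositional_extensionality; split; [apply h2 | apply h1]. }
rewrite e; intros eps; apply ball_center.
Qed.

Definition choice_complete_mixin : CompleteSpace.mixin_of T :=
  CompleteSpace.Mixin T choice_lim choice_lim_ax1 choice_lim_ax2.
End CompleteFromLimits.

Section HilbertSum.
Variables H1 H2 : Hilbert.

Lemma hsum_has_lim (F : (H1 * H2 -> Prop) -> Prop) :
  ProperFilter F -> cauchy F ->
  exists x, forall eps : posreal, F (ball x eps).
Proof.
intros pF cF.
set (F1 := filtermap (fst : H1 * H2 -> H1) F).
set (F2 := filtermap (snd : H1 * H2 -> H2) F).
assert (p1 : ProperFilter F1) by (apply filtermap_proper_filter, pF).
assert (p2 : ProperFilter F2) by (apply filtermap_proper_filter, pF).
assert (c1 : cauchy F1).
{ intros eps; destruct (cF eps) as [x hx]; exists (fst x).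
  unfold F1, filtermap; revert hx; apply filter_imp; intros y [h _]; exact h. }
assert (c2 : cauchy F2).
{ intros eps; destruct (cF eps) as [x hx]; exists (snd x).
  unfold F2, filtermap; revert hx; apply filter_imp; intros y [_ h]; exact h. }
exists (lim F1, lim F2); intros eps.
generalize (complete_cauchy F1 p1 c1 eps) (complete_cauchy F2 p2 c2 eps).
unfold F1 at 1, F2 at 1, filtermap; intros h1 h2.
generalize (filter_and _ _ h1 h2); apply filter_imp.
intros y [k1 k2]; split; assumption.
Qed.

Definition hsum_space : CompleteNormedModule C_AbsRing :=
  CompleteNormedModule.Pack C_AbsRing (H1 * H2)
    (CompleteNormedModule.Class C_AbsRing (H1 * H2)
       (NormedModule.class C_AbsRing (prod_NormedModule C_AbsRing H1 H2))
       (choice_complete_mixin (prod_NormedModule C_AbsRing H1 H2)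
          hsum_has_lim zero))
    (H1 * H2).

Definition hsum_inner (x y : hsum_space) : C :=
  Cplus (inner (fst x) (fst y)) (inner (snd x) (snd y)).

Lemma hsum_inner_norm (x : hsum_space) :
  hsum_inner x x = RtoC (norm x ^ 2).
Proof.
unfold hsum_inner; rewrite 2!inner_norm, <- RtoC_plus.
change (norm x) with (sqrt (norm (fst x) ^ 2 + norm (snd x) ^ 2)).
rewrite pow2_sqrt; [reflexivity |].
apply Rplus_le_le_0_compat; apply pow2_ge_0.
Qed.

Definition hsum : Hilbert.
Proof.
refine (mkHilbert hsum_space hsum_inner _ _ _ hsum_inner_norm).
- intros [x1 x2] [y1 y2] [z1 z2]; unfold hsum_inner; simpl.
  rewrite 2!inner_plus_l; ring.
- intros c [x1 x2] [y1 y2]; unfold hsum_inner; simpl.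
  rewrite 2!inner_scal_l; ring.
- intros [x1 x2] [y1 y2]; unfold hsum_inner; simpl.
  rewrite (inner_sym _ x1 y1), (inner_sym _ x2 y2), Cplus_conj; reflexivity.
Defined.
End HilbertSum.

Record enumeration (I : Type) := mkEnum {
  enum :> nat -> I;
  enum_inj : forall i j, enum i = enum j -> i = j;
  enum_surj : forall x, exists i, enum i = x
}.

Definition nat_enum : enumeration nat.
Proof.
refine (mkEnum nat (fun i => i) _ _); [auto | intros x; exists x; reflexivity].
Defined.

(* 0, -1, 1, -2, 2, ... *)
Definition Z_of_index (i : nat) : Z :=
  if Nat.even i then Z.of_nat (Nat.div2 i) else (- Z.of_nat (Nat.div2 i) - 1)%Z.

Definition Z_enum : enumeration Z.
Proof.
refine (mkEnum Z Z_of_index _ _).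
- intros i j; unfold Z_of_index.
  generalize (Nat.div2_odd i) (Nat.div2_odd j).
  rewrite <- !Nat.negb_even.
  destruct (Nat.even i), (Nat.even j); cbn [negb Nat.b2n]; intros; lia.
- intros z; destruct (Z_le_dec 0 z) as [h | h].
  + exists (2 * Z.to_nat z)%nat; unfold Z_of_index.
    rewrite Nat.even_mul, Nat.div2_double; cbn [Nat.even orb]; lia.
  + exists (S (2 * Z.to_nat (- z - 1))); unfold Z_of_index.
    rewrite Nat.even_succ, Nat.odd_mul, Nat.div2_succ_double.
    change (Nat.odd 2) with false; cbn [andb]; lia.
Defined.

Lemma ex_series_scal_R (c : R) (u : nat -> R) :
  ex_series u -> ex_series (fun k => c * u k).
Proof. exact (ex_series_scal (K := R_AbsRing) (V := R_NormedModule) c u). Qed.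

Section WeightedL2.
Variables (I : Type) (e : enumeration I) (w : I -> R).
Hypothesis w_pos : forall i, 0 < w i.

Record l2 := mkL2 {
  coef :> I -> C;
  coef_summable : ex_series (fun k => w (e k) * Cmod (coef (e k)) ^ 2)
}.

Lemma l2_ext (a b : l2) : (forall i, a i = b i) -> a = b.
Proof.
destruct a as [a ha], b as [b hb]; simpl; intros h.
assert (a = b) by (apply functional_extensionality, h); subst b.
f_equal; apply proof_irrelevance.
Qed.

Notation sq a := (fun k : nat => w (e k) * Cmod (a (e k)) ^ 2).
Notation rp a b :=
  (fun k : nat => w (e k) * Re (Cmult (a (e k)) (Cconj (b (e k))))).
Notation ip a b :=
  (fun k : nat => w (e k) * Im (Cmult (a (e k)) (Cconj (b (e k))))).

Lemma sq_pos (a : I -> C) k : 0 <= sq a k.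
Proof.
apply Rmult_le_pos; [left; apply w_pos | apply pow2_ge_0].
Qed.

Lemma prod_le (x y : C) : Cmod (Cmult x (Cconj y)) <= Cmod x ^ 2 + Cmod y ^ 2.
Proof.
rewrite Cmod_mult, Cmod_conj.
generalize (Cmod_ge_0 x) (Cmod_ge_0 y) (pow2_ge_0 (Cmod x - Cmod y)); nra.
Qed.

Lemma ex_sq_add (a b : l2) : ex_series (fun k => sq a k + sq b k).
Proof. apply (ex_series_plus (sq a) (sq b)); apply coef_summable. Qed.

Lemma ex_rp (a b : l2) : ex_series (rp a b).
Proof.
apply (ex_series_le (K := R_AbsRing) (V := R_CompleteNormedModule)) with (2 := ex_sq_add a b).
intros k; change norm with Rabs; rewrite Rabs_mult, (Rabs_pos_eq (w _)) by (left; apply w_pos).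
rewrite <- Rmult_plus_distr_l; apply Rmult_le_compat_l; [left; apply w_pos |].
eapply Rle_trans; [apply re_le_Cmod | apply prod_le].
Qed.

Lemma im_le_Cmod' (c : C) : Rabs (Im c) <= Cmod c.
Proof.
eapply Rle_trans; [| apply Rmax_Cmod]; apply Rmax_r.
Qed.

Lemma ex_ip (a b : l2) : ex_series (ip a b).
Proof.
apply (ex_series_le (K := R_AbsRing) (V := R_CompleteNormedModule)) with (2 := ex_sq_add a b).
intros k; change norm with Rabs; rewrite Rabs_mult, (Rabs_pos_eq (w _)) by (left; apply w_pos).
rewrite <- Rmult_plus_distr_l; apply Rmult_le_compat_l; [left; apply w_pos |].
eapply Rle_trans; [apply im_le_Cmod' | apply prod_le].
Qed.

Lemma Cmod_plus_sq (x y : C) :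
  Cmod (Cplus x y) ^ 2
  = Cmod x ^ 2 + 2 * Re (Cmult x (Cconj y)) + Cmod y ^ 2.
Proof.
rewrite !Cmod2_alt; destruct x as [x1 x2], y as [y1 y2]; simpl; ring.
Qed.

Lemma l2_plus_sum (a b : l2) :
  ex_series (sq (fun i => Cplus (a i) (b i))).
Proof.
apply (ex_series_ext (fun k => (sq a k + sq b k) + 2 * rp a b k)).
{ intros k; eq_in R; rewrite Cmod_plus_sq; ring. }
apply (ex_series_plus (V := R_NormedModule)); [apply ex_sq_add |].
apply ex_series_scal_R, ex_rp.
Qed.
Definition l2_plus (a b : l2) : l2 := mkL2 _ (l2_plus_sum a b).

Lemma l2_scal_sum (c : C) (a : l2) : ex_series (sq (fun i => Cmult c (a i))).
Proof.
apply (ex_series_ext (fun k => Cmod c ^ 2 * sq a k)).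
{ intros k; eq_in R; rewrite Cmod_mult; ring. }
apply ex_series_scal_R, coef_summable.
Qed.
Definition l2_scal (c : C) (a : l2) : l2 := mkL2 _ (l2_scal_sum c a).

Lemma l2_opp_sum (a : l2) : ex_series (sq (fun i => Copp (a i))).
Proof.
apply (ex_series_ext (sq a)); [| apply coef_summable].
intros k; rewrite Cmod_opp; reflexivity.
Qed.
Definition l2_opp (a : l2) : l2 := mkL2 _ (l2_opp_sum a).

Lemma l2_zero_sum : ex_series (sq (fun _ : I => RtoC 0)).
Proof.
exists 0; apply (is_series_ext (fun _ => 0)).
{ intros k; eq_in R; rewrite Cmod_0; simpl; ring. }
apply (is_lim_seq_ext (fun _ => 0) _ 0); [| apply is_lim_seq_const].
intros n; rewrite sum_n_const; ring.
Qed.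
Definition l2_zero : l2 := mkL2 _ l2_zero_sum.

Definition l2_AbelianMonoid_mixin : AbelianMonoid.mixin_of l2.
Proof.
refine (AbelianMonoid.Mixin l2 l2_plus l2_zero _ _ _);
  intros; apply l2_ext; intros i; cbn; ring.
Defined.
Definition l2_AbelianMonoid :=
  AbelianMonoid.Pack l2 l2_AbelianMonoid_mixin l2.
Definition l2_AbelianGroup_mixin : AbelianGroup.mixin_of l2_AbelianMonoid.
Proof.
refine (AbelianGroup.Mixin l2_AbelianMonoid l2_opp _);
  intros; apply l2_ext; intros i; cbn; ring.
Defined.
Definition l2_AbelianGroup :=
  AbelianGroup.Pack l2
    (AbelianGroup.Class l2 l2_AbelianMonoid_mixin l2_AbelianGroup_mixin) l2.
Definition l2_ModuleSpace_mixin : ModuleSpace.mixin_of C_Ring l2_AbelianGroup.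
Proof.
refine (ModuleSpace.Mixin C_Ring l2_AbelianGroup l2_scal _ _ _ _);
  intros; apply l2_ext; intros i; simpl.
- change mult with Cmult; ring.
- change one with (RtoC 1); ring.
- ring.
- change plus with Cplus; ring.
Defined.
Definition l2_ModuleSpace_class : ModuleSpace.class_of C_Ring l2 :=
  ModuleSpace.Class C_Ring l2 (AbelianGroup.class l2_AbelianGroup)
    l2_ModuleSpace_mixin.

Definition l2_inner (a b : l2) : C := (Series (rp a b), Series (ip a b)).
Definition l2_norm (a : l2) : R := sqrt (Series (sq a)).

Lemma Series_pos (u : nat -> R) :
  (forall k, 0 <= u k) -> ex_series u -> 0 <= Series u.
Proof.
intros hu hs.
replace 0 with (Series (fun k => 0 * u k)) by (rewrite Series_scal_l; ring).
apply Series_le; [| exact hs].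
intros n; generalize (hu n); lra.
Qed.

Lemma sqs_pos (a : l2) : 0 <= Series (sq a).
Proof. apply Series_pos; [apply sq_pos | apply coef_summable]. Qed.

Lemma l2_norm_pos (a : l2) : 0 <= l2_norm a.
Proof. apply sqrt_pos. Qed.

Lemma l2_norm_sq (a : l2) : l2_norm a ^ 2 = Series (sq a).
Proof. apply pow2_sqrt, sqs_pos. Qed.

Lemma sqs_combine (a b : l2) (t : R) :
  Series (sq (l2_plus a (l2_scal (RtoC t) b)))
  = Series (sq a) + 2 * t * Series (rp a b) + t ^ 2 * Series (sq b).
Proof.
rewrite <- (Series_scal_l (2 * t)), <- (Series_scal_l (t ^ 2)).
rewrite <- 2!Series_plus.
- apply Series_ext; intros k; simpl coef; rewrite Cmod_plus_sq.
  rewrite Cmod_mult, Cmod_R, Cmult_conj.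
  rewrite Rpow_mult_distr, pow2_abs.
  destruct (a (e k)) as [x1 x2], (b (e k)) as [y1 y2]; simpl; ring.
- apply (ex_series_plus (V := R_NormedModule)); [apply coef_summable |].
  apply ex_series_scal_R, ex_rp.
- apply ex_series_scal_R, coef_summable.
- apply coef_summable.
- apply ex_series_scal_R, ex_rp.
Qed.

Lemma pow2_le (x y : R) : x ^ 2 <= y ^ 2 -> 0 <= y -> x <= y.
Proof. rewrite <- !Rsqr_pow2; apply Rsqr_incr_0_var. Qed.

Lemma l2_cauchy_schwarz (a b : l2) :
  Series (rp a b) <= l2_norm a * l2_norm b.
Proof.
set (r := Series (rp a b)).
assert (h : forall t, 0 <= l2_norm a ^ 2 + 2 * t * r + t ^ 2 * l2_norm b ^ 2).
{ intros t; rewrite !l2_norm_sq; unfold r; rewrite <- sqs_combine; apply sqs_pos. }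
generalize (l2_norm_pos a) (l2_norm_pos b); intros ha hb.
destruct (Rle_lt_dec r 0) as [hr | hr].
{ generalize (Rmult_le_pos _ _ ha hb); lra. }
destruct (Req_dec (l2_norm b) 0) as [h0 | h0].
- exfalso; specialize (h (- (l2_norm a ^ 2 + 1) / (2 * r))); rewrite h0 in h.
  replace (2 * (- (l2_norm a ^ 2 + 1) / (2 * r)) * r)
    with (- (l2_norm a ^ 2 + 1)) in h by (field; lra).
  lra.
- specialize (h (- r / l2_norm b ^ 2)).
  assert (hb' : 0 < l2_norm b) by lra.
  replace (l2_norm a ^ 2 + 2 * (- r / l2_norm b ^ 2) * r
           + (- r / l2_norm b ^ 2) ^ 2 * l2_norm b ^ 2)
    with ((l2_norm a ^ 2 * l2_norm b ^ 2 - r ^ 2) / l2_norm b ^ 2) in h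
    by (field; lra).
  assert (hb2 : 0 < l2_norm b ^ 2) by (apply pow_lt, hb').
  assert (0 <= l2_norm a ^ 2 * l2_norm b ^ 2 - r ^ 2).
  { apply (Rmult_le_compat_r (l2_norm b ^ 2)) in h; [| lra].
    unfold Rdiv in h; rewrite Rmult_assoc, Rinv_l in h; lra. }
  apply pow2_le; [nra | apply Rmult_le_pos; auto].
Qed.

Lemma l2_triangle (a b : l2) : l2_norm (l2_plus a b) <= l2_norm a + l2_norm b.
Proof.
generalize (l2_norm_pos a) (l2_norm_pos b); intros ha hb.
generalize (l2_cauchy_schwarz a b); intros h.
apply pow2_le; [| lra].
rewrite l2_norm_sq.
replace (l2_plus a b) with (l2_plus a (l2_scal (RtoC 1) b)).
2: { apply l2_ext; intros i; simpl; ring. }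
rewrite sqs_combine, <- !l2_norm_sq; nra.
Qed.

Lemma l2_norm_scal (c : C) (a : l2) : l2_norm (l2_scal c a) = Cmod c * l2_norm a.
Proof.
unfold l2_norm.
rewrite (Series_ext _ (fun k => Cmod c ^ 2 * sq a k)).
2: { intros k; simpl coef; rewrite Cmod_mult; ring. }
rewrite Series_scal_l, sqrt_mult_alt by apply pow2_ge_0.
rewrite sqrt_pow2 by apply Cmod_ge_0; reflexivity.
Qed.

Lemma sum_le_Series (u : nat -> R) n :
  (forall k, 0 <= u k) -> ex_series u -> sum_n u n <= Series u.
Proof.
intros hu hs.
apply (is_lim_seq_incr_compare (sum_n u)).
- apply (Series_correct u hs).
- intros m; rewrite sum_Sn; change plus with Rplus; generalize (hu (S m)); lra.
Qed.

Lemma coef_le (a : l2) k : w (e k) * Cmod (a (e k)) ^ 2 <= l2_norm a ^ 2.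
Proof.
rewrite l2_norm_sq.
apply Rle_trans with (sum_n (sq a) k).
- destruct k; [rewrite sum_O; lra |].
  rewrite sum_Sn; change plus with Rplus.
  assert (0 <= sum_n (sq a) k); [| lra].
  rewrite sum_n_Reals; apply cond_pos_sum; intros; apply sq_pos.
- apply sum_le_Series; [apply sq_pos | apply coef_summable].
Qed.

Definition l2_ball (x : l2) (r : R) (y : l2) : Prop :=
  l2_norm (l2_plus y (l2_opp x)) < r.

Lemma l2_norm_zero : l2_norm l2_zero = 0.
Proof.
replace l2_zero with (l2_scal (RtoC 0) l2_zero).
- rewrite l2_norm_scal, Cmod_0; ring.
- apply l2_ext; intros i; simpl coef; ring.
Qed.

Lemma l2_norm_opp (a : l2) : l2_norm (l2_opp a) = l2_norm a.
Proof.
replace (l2_opp a) with (l2_scal (RtoC (-1)) a).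
- rewrite l2_norm_scal, Cmod_R, Rabs_left; lra.
- apply l2_ext; intros i; simpl coef; replace (RtoC (-1)) with (Copp (RtoC 1)) by (rewrite <- RtoC_opp; reflexivity).
  ring.
Qed.

Definition l2_UniformSpace_mixin : UniformSpace.mixin_of l2.
Proof.
refine (UniformSpace.Mixin l2 l2_zero l2_ball _ _ _); unfold l2_ball.
- intros x eps.
  replace (l2_plus x (l2_opp x)) with l2_zero.
  2: { apply l2_ext; intros i; simpl coef; ring. }
  rewrite l2_norm_zero; apply cond_pos.
- intros x y r h.
  replace (l2_plus x (l2_opp y)) with (l2_opp (l2_plus y (l2_opp x))).
  2: { apply l2_ext; intros i; simpl coef; ring. }
  rewrite l2_norm_opp; exact h.
- intros x y z r s h k.
  replace (l2_plus z (l2_opp x))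
    with (l2_plus (l2_plus z (l2_opp y)) (l2_plus y (l2_opp x))).
  2: { apply l2_ext; intros i; simpl coef; ring. }
  eapply Rle_lt_trans; [apply l2_triangle | lra].
Defined.

Definition l2_NormedModuleAux : NormedModuleAux C_AbsRing :=
  NormedModuleAux.Pack C_AbsRing l2
    (NormedModuleAux.Class C_AbsRing l2 l2_ModuleSpace_class
       l2_UniformSpace_mixin) l2.

Lemma l2_norm_eq0 (x : l2) : l2_norm x = 0 -> x = l2_zero.
Proof.
intros h; apply l2_ext; intros i; simpl coef.
destruct (enum_surj _ e i) as [k <-].
apply Cmod_eq_0.
generalize (coef_le x k) (w_pos (e k)) (Cmod_ge_0 (x (e k))).
rewrite h; intros h1 h2 h3.
destruct (Rle_lt_or_eq_dec _ _ h3) as [h4 | h4]; [exfalso | auto].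
generalize (Rmult_lt_0_compat _ _ h2 (pow_lt _ 2 h4)); lra.
Qed.

Definition l2_NormedModule_mixin :
  NormedModule.mixin_of C_AbsRing l2_NormedModuleAux.
Proof.
refine (NormedModule.Mixin C_AbsRing l2_NormedModuleAux l2_norm 1 _ _ _ _ _).
- apply l2_triangle.
- intros c x; apply Req_le, l2_norm_scal.
- intros x y eps h; exact h.
- intros x y eps h; rewrite Rmult_1_l; exact h.
- apply l2_norm_eq0.
Defined.

Definition l2_NormedModule : NormedModule C_AbsRing :=
  NormedModule.Pack C_AbsRing l2
    (NormedModule.Class C_AbsRing l2
       (NormedModuleAux.class C_AbsRing l2_NormedModuleAux)
       l2_NormedModule_mixin) l2.

Lemma Cmod_sq_continuous (r : R) (c z : C) :
  continuous (fun y : C => r * Cmod (Cplus y (Copp c)) ^ 2) z.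
Proof.
apply (continuous_ext (fun y : C =>
  r * ((fst y - fst c) * (fst y - fst c) + (snd y - snd c) * (snd y - snd c)))).
{ intros y; rewrite Cmod2_alt; destruct y, c; simpl; ring. }
assert (h1 : continuous (fun y : C => fst y - fst c) z).
{ apply (continuous_minus (fun y : C => fst y)); [apply continuous_fst |].
  apply continuous_const. }
assert (h2 : continuous (fun y : C => snd y - snd c) z).
{ apply (continuous_minus (fun y : C => snd y)); [apply continuous_snd |].
  apply continuous_const. }
apply (continuous_mult (fun _ => r)); [apply continuous_const |].
apply (continuous_plus (V := R_NormedModule));
  apply (continuous_mult (K := R_AbsRing)); assumption.
Qed.

Section Limit.
Variable F : (l2 -> Prop) -> Prop.
Hypothesis pF : ProperFilter F.
Hypothesis cF : forall eps : posreal, exists x, F (l2_ball x eps).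

Notation coord i := (filtermap (fun y : l2 => y i) F).

Lemma coord_cauchy i : cauchy (T := C_UniformSpace) (coord i).
Proof.
destruct (enum_surj _ e i) as [k <-].
intros eps.
assert (hs : 0 < sqrt (w (e k))) by apply sqrt_lt_R0, w_pos.
destruct (cF (mkposreal _ (Rmult_lt_0_compat _ _ (cond_pos eps) hs))) as [x hx].
exists (x (e k)); unfold filtermap; revert hx; apply filter_imp.
unfold l2_ball; simpl; intros y hy.
apply C_NormedModule_mixin_compat1.
change (Cmod (Cplus (y (e k)) (Copp (x (e k)))) < eps).
set (d := l2_plus y (l2_opp x)) in hy.
change (Cmod (d (e k)) < eps).
generalize (coef_le d k) (l2_norm_pos d) (Cmod_ge_0 (d (e k))) (cond_pos eps).
intros h1 h2 h3 h4.
assert (h5 : l2_norm d ^ 2 < (eps * sqrt (w (e k))) ^ 2) by nra.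
rewrite Rpow_mult_distr, pow2_sqrt in h5 by (left; apply w_pos).
apply Rnot_le_lt; intros h6.
assert (h7 : eps ^ 2 <= Cmod (d (e k)) ^ 2) by (apply pow_incr; lra).
generalize (w_pos (e k)); nra.
Qed.

Definition lim_coef (i : I) : C := C_complete_lim (coord i).

Lemma coord_lim i : filterlim (fun y : l2 => y i) F (locally (lim_coef i)).
Proof.
apply (filterlim_locally (U := C_UniformSpace)); intros eps.
apply (C_complete_ax1 (coord i)).
- apply filtermap_proper_filter, pF.
- apply coord_cauchy.
Qed.

Lemma partial_lim (x : l2) n :
  filterlim (fun y : l2 => sum_n (sq (fun i => Cplus (y i) (Copp (x i)))) n) F
    (locally (sum_n (sq (fun i => Cplus (lim_coef i) (Copp (x i)))) n)).
Proof.
assert (h : forall k, filterlim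
  (fun y : l2 => sq (fun i => Cplus (y i) (Copp (x i))) k) F
  (locally (sq (fun i => Cplus (lim_coef i) (Copp (x i))) k))).
{ intros k.
  apply (filterlim_comp _ _ _ (fun y : l2 => y (e k))
    (fun z : C => w (e k) * Cmod (Cplus z (Copp (x (e k)))) ^ 2)
    _ (locally (lim_coef (e k)))); [apply coord_lim |].
  apply Cmod_sq_continuous. }
induction n as [| n IH].
- rewrite sum_O.
  apply filterlim_ext with (2 := h 0%nat); intros y; rewrite sum_O; reflexivity.
- rewrite sum_Sn.
  apply (filterlim_ext (fun y : l2 =>
    plus (sum_n (sq (fun i => Cplus (y i) (Copp (x i)))) n)
         (sq (fun i => Cplus (y i) (Copp (x i))) (S n)))).
  { intros y; rewrite sum_Sn; reflexivity. }
  eapply filterlim_comp_2; [exact IH | exact (h (S n)) |].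
  apply (filterlim_plus (V := R_NormedModule)).
Qed.

Lemma partial_bound (x : l2) (r : R) : 0 < r -> F (l2_ball x r) ->
  forall n, sum_n (sq (fun i => Cplus (lim_coef i) (Copp (x i)))) n <= r ^ 2.
Proof.
intros hr hx n.
change (Rbar_le (Finite (sum_n (sq (fun i => Cplus (lim_coef i) (Copp (x i)))) n))
  (Finite (r ^ 2))).
apply (filterlim_le (F := F)
  (fun y : l2 => sum_n (sq (fun i => Cplus (y i) (Copp (x i)))) n)
  (fun _ => r ^ 2)).
- revert hx; apply filter_imp; unfold l2_ball; intros y hy.
  set (d := l2_plus y (l2_opp x)) in hy.
  apply Rle_trans with (l2_norm d ^ 2).
  + rewrite l2_norm_sq; apply sum_le_Series; [apply sq_pos | apply coef_summable].
  + generalize (l2_norm_pos d); intros; apply pow_incr; lra.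
- apply partial_lim.
- apply filterlim_const.
Qed.

Lemma bounded_ex_series (u : nat -> R) (M : R) :
  (forall k, 0 <= u k) -> (forall n, sum_n u n <= M) -> ex_series u.
Proof.
intros hu hM.
destruct (ex_finite_lim_seq_incr (sum_n u) M) as [l hl]; [| exact hM |].
- intros n; rewrite sum_Sn; change plus with Rplus; generalize (hu (S n)); lra.
- exists l; exact hl.
Qed.

Lemma Series_le_bound (u : nat -> R) (M : R) :
  ex_series u -> (forall n, sum_n u n <= M) -> Series u <= M.
Proof.
intros hs hM.
change (Rbar_le (Finite (Series u)) (Finite M)).
apply (is_lim_seq_le (sum_n u) (fun _ => M)); [exact hM | | apply is_lim_seq_const].
exact (Series_correct u hs).
Qed.

Lemma diff_sum (x : l2) (r : R) : 0 < r -> F (l2_ball x r) ->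
  ex_series (sq (fun i => Cplus (lim_coef i) (Copp (x i)))).
Proof.
intros hr hx; apply bounded_ex_series with (r ^ 2).
- exact (sq_pos (fun i => Cplus (lim_coef i) (Copp (x i)))).
- apply partial_bound; assumption.
Qed.

Lemma l2_limit : exists b : l2, forall eps : posreal, F (l2_ball b eps).
Proof.
destruct (cF (mkposreal 1 Rlt_0_1)) as [x0 h0]; simpl in h0.
set (b0 := l2_plus (mkL2 _ (diff_sum x0 1 Rlt_0_1 h0)) x0).
assert (hb : forall i, b0 i = lim_coef i) by (intros i; simpl coef; ring).
exists b0; intros eps.
destruct (cF (mkposreal _ (is_pos_div_2 eps))) as [x hx]; simpl in hx.
assert (h : l2_norm (l2_plus b0 (l2_opp x)) <= eps / 2).
{ apply pow2_le; [| generalize (cond_pos eps); lra].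
  rewrite l2_norm_sq; apply Series_le_bound; [apply coef_summable |].
  intros n.
  rewrite (sum_n_ext _ (sq (fun i => Cplus (lim_coef i) (Copp (x i))))).
  - apply partial_bound; [apply is_pos_div_2 | exact hx].
  - intros k; rewrite <- hb; reflexivity. }
generalize hx; apply filter_imp; unfold l2_ball; intros y hy.
replace (l2_plus y (l2_opp b0))
  with (l2_plus (l2_plus y (l2_opp x)) (l2_opp (l2_plus b0 (l2_opp x)))).
2: { apply l2_ext; intros i; simpl coef; ring. }
eapply Rle_lt_trans; [apply l2_triangle |].
rewrite l2_norm_opp; lra.
Qed.
End Limit.

Definition l2_CompleteNormedModule : CompleteNormedModule C_AbsRing :=
  CompleteNormedModule.Pack C_AbsRing l2
    (CompleteNormedModule.Class C_AbsRing l2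
       (NormedModule.class C_AbsRing l2_NormedModule)
       (choice_complete_mixin l2_NormedModule l2_limit l2_zero)) l2.

Definition l2_Hilbert : Hilbert.
Proof.
refine (mkHilbert l2_CompleteNormedModule l2_inner _ _ _ _).
- intros x y z; unfold l2_inner, Cplus; simpl fst; simpl snd.
  f_equal; rewrite <- Series_plus; try apply ex_rp; try apply ex_ip;
    apply Series_ext; intros k; simpl; ring.
- intros c x y; unfold l2_inner, Cmult at 3; simpl fst; simpl snd.
  rewrite <- !Series_scal_l.
  f_equal; [rewrite <- Series_minus | rewrite <- Series_plus];
    try (apply ex_series_scal_R; (apply ex_rp || apply ex_ip));
    apply Series_ext; intros k; simpl; ring.
- intros x y; unfold l2_inner, Cconj; simpl fst; simpl snd.
  rewrite <- Series_opp; f_equal; apply Series_ext; intros k; simpl; ring.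
- intros x; change (norm x) with (l2_norm x); rewrite l2_norm_sq.
  unfold l2_inner, RtoC; f_equal.
  + apply Series_ext; intros k; rewrite Cmod2_alt.
    destruct (coef x (e k)) as [u v]; unfold Re, Im, Cconj, Cmult; cbn [fst snd]; ring.
  + rewrite (Series_ext _ (fun k => 0 * 0)).
    * rewrite Series_scal_l; ring.
    * intros k; simpl; ring.
Defined.
End WeightedL2.

Definition Gamma (x : R) : R :=
  RInt_gen (fun t => Rpower t (x - 1) * exp (- t))
    (at_right 0) (Rbar_locally p_infty).

Section GammaPositive.
Variable x : R.
Hypothesis x_pos : 0 < x.
Notation f := (fun t : R => Rpower t (x - 1) * exp (- t)).

Lemma gamma_f_pos t : 0 < f t.
Proof. apply Rmult_lt_0_compat; apply exp_pos. Qed.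

Lemma gamma_f_cont t : 0 < t -> continuous f t.
Proof.
intros ht; apply (ex_derive_continuous f); unfold Rpower; auto_derive; exact ht.
Qed.

Lemma gamma_ex_RInt a b : 0 < a -> 0 < b -> ex_RInt f a b.
Proof.
intros ha hb; apply (ex_RInt_continuous (V := R_CompleteNormedModule)).
intros t [h _]; apply gamma_f_cont.
eapply Rlt_le_trans; [| exact h]; apply Rmin_case; assumption.
Qed.

Lemma gamma_RInt_pos a b : 0 < a -> a <= b -> 0 <= RInt f a b.
Proof.
intros ha hb; apply RInt_ge_0; [exact hb | apply gamma_ex_RInt; lra |].
intros t _; left; apply gamma_f_pos.
Qed.

Lemma gamma_Chasles a b c : 0 < a -> 0 < b -> 0 < c ->
  RInt f a b + RInt f b c = RInt f a c.
Proof.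
intros ha hb hc.
exact (RInt_Chasles (V := R_CompleteNormedModule) f a b c
  (gamma_ex_RInt a b ha hb) (gamma_ex_RInt b c hb hc)).
Qed.

Lemma gamma_bound_0 a : 0 < a -> a <= 1 -> RInt f a 1 <= / x.
Proof.
intros ha h1.
set (g := fun t => Rpower t (x - 1)).
assert (hg : is_RInt g a 1 (minus (/ x * Rpower 1 x) (/ x * Rpower a x))).
{ apply (is_RInt_derive (V := R_CompleteNormedModule) (fun t => / x * Rpower t x)).
  - intros t; rewrite Rmin_left, Rmax_right by lra; intros ht.
    unfold g, Rpower; auto_derive; [lra |].
    replace ((x - 1) * ln t) with (x * ln t - ln t) by ring.
    unfold Rminus; rewrite exp_plus, exp_Ropp, exp_ln by lra.
    field; lra.
  - intros t; rewrite Rmin_left, Rmax_right by lra; intros ht.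
    apply (ex_derive_continuous g); unfold g, Rpower; auto_derive; lra. }
apply Rle_trans with (RInt g a 1).
- apply RInt_le; [exact h1 | apply gamma_ex_RInt; lra | eexists; exact hg |].
  intros t ht; unfold g; rewrite <- (Rmult_1_r (Rpower t (x - 1))) at 2.
  apply Rmult_le_compat_l; [left; apply exp_pos |].
  rewrite <- exp_0; left; apply exp_increasing; lra.
- rewrite (is_RInt_unique _ _ _ _ hg).
  unfold minus, plus, opp; simpl.
  replace (Rpower 1 x) with 1 by (unfold Rpower; rewrite ln_1, Rmult_0_r, exp_0; reflexivity).
  assert (0 < / x * Rpower a x)
    by (apply Rmult_lt_0_compat; [apply Rinv_0_lt_compat, x_pos | apply exp_pos]).
  lra.
Qed.

Lemma ln_le_sub_1 u : 0 < u -> ln u <= u - 1.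
Proof.
intros hu; generalize (exp_ineq1_le (ln u)); rewrite exp_ln by exact hu; lra.
Qed.

Lemma gamma_bound_infty :
  exists M, forall b, 1 <= b -> RInt f 1 b <= M.
Proof.
set (p := Rabs (x - 1)); assert (hp : 0 <= p) by apply Rabs_pos.
set (c := 2 * (p + 1)); assert (hc : 2 <= c) by (unfold c; lra).
set (K := p * ln c).
set (g := fun t => exp (K - t / 2)).
exists (2 * exp (K - 1 / 2)); intros b hb.
assert (hg : is_RInt g 1 b (minus (-2 * exp (K - b / 2)) (-2 * exp (K - 1 / 2)))).
{ apply (is_RInt_derive (V := R_CompleteNormedModule) (fun t => -2 * exp (K - t / 2))).
  - intros t _; unfold g; auto_derive; [exact I |]; unfold Rminus, Rdiv; field.
  - intros t _; apply (ex_derive_continuous g); unfold g; auto_derive; exact I. }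
apply Rle_trans with (RInt g 1 b).
- apply RInt_le; [exact hb | apply gamma_ex_RInt; lra | eexists; exact hg |].
  intros t ht; unfold g, Rpower; rewrite <- exp_plus.
  assert (h : (x - 1) * ln t + - t <= K - t / 2).
  { assert (hl : 0 <= ln t) by (rewrite <- ln_1; apply ln_le; lra).
    assert (h1 : (x - 1) * ln t <= p * ln t)
      by (apply Rmult_le_compat_r; [exact hl | apply Rle_abs]).
    assert (h2 : ln t <= t / c - 1 + ln c).
    { replace t with (t / c * c) at 1 by (field; lra).
      assert (0 < t / c) by (apply Rdiv_lt_0_compat; lra).
      rewrite ln_mult by lra; generalize (ln_le_sub_1 (t / c)); lra. }
    assert (h3 : p * ln t <= p * (t / c - 1 + ln c))
      by (apply Rmult_le_compat_l; assumption).
    assert (h4 : p * (t / c) <= t / 2).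
    { replace (t / 2) with ((p + 1) * (t / c)) by (unfold c; field; lra).
      apply Rmult_le_compat_r; [| lra].
      left; apply Rdiv_lt_0_compat; lra. }
    unfold K; nra. }
  destruct h as [h | h]; [left; apply exp_increasing, h | rewrite h; lra].
- rewrite (is_RInt_unique _ _ _ _ hg).
  unfold minus, plus, opp; simpl; generalize (exp_pos (K - b / 2)); lra.
Qed.

Lemma gamma_at_infty : exists l, RInt f 1 2 <= l /\
  is_RInt_gen f (at_point 1) (Rbar_locally p_infty) l.
Proof.
destruct gamma_bound_infty as [M hM].
set (E := fun y => exists b, 1 <= b /\ y = RInt f 1 b).
destruct (completeness E) as [l [hl1 hl2]].
- exists M; intros y [b [hb ->]]; apply hM, hb.
- exists (RInt f 1 1), 1; split; [lra | reflexivity].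
- exists l; split; [apply hl1; exists 2; split; [lra | reflexivity] |].
  intros P [eps hP].
  assert (hex : exists b, 1 <= b /\ l - eps < RInt f 1 b).
  { apply NNPP; intros hn.
    assert (h : l <= l - eps).
    { apply hl2; intros y [b [hb ->]]; apply Rnot_lt_le; intros hlt.
      apply hn; exists b; split; assumption. }
    generalize (cond_pos eps); lra. }
  destruct hex as [b0 [hb0 hlt]].
  exists (fun a => a = 1) (fun b => b0 < b).
  + reflexivity.
  + exists b0; auto.
  + intros a b -> hb; exists (RInt f 1 b); split.
    * apply (RInt_correct (V := R_CompleteNormedModule)), gamma_ex_RInt; simpl; lra.
    * apply hP; change (Rabs (RInt f 1 b - l) < eps).
      assert (RInt f 1 b <= l) by (apply hl1; exists b; split; [lra | reflexivity]).
      generalize (gamma_Chasles 1 b0 b) (gamma_RInt_pos b0 b); intros h1 h2.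
      apply Rabs_def1; generalize (cond_pos eps); lra.
Qed.

Lemma gamma_at_0 : exists l, 0 <= l /\
  is_RInt_gen f (at_right 0) (at_point 1) l.
Proof.
set (E := fun y => exists a, 0 < a /\ a <= 1 /\ y = RInt f a 1).
destruct (completeness E) as [l [hl1 hl2]].
- exists (/ x); intros y [a [ha [ha' ->]]]; apply gamma_bound_0; assumption.
- exists (RInt f 1 1), 1; repeat split; lra.
- exists l; split.
  { apply Rle_trans with (RInt f 1 1); [apply gamma_RInt_pos; lra |].
    apply hl1; exists 1; repeat split; lra. }
  intros P [eps hP].
  assert (hex : exists a, 0 < a /\ a <= 1 /\ l - eps < RInt f a 1).
  { apply NNPP; intros hn.
    assert (h : l <= l - eps).
    { apply hl2; intros y [a [ha [ha' ->]]]; apply Rnot_lt_le; intros hlt.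
      apply hn; exists a; repeat split; assumption. }
    generalize (cond_pos eps); lra. }
  destruct hex as [a0 [ha0 [ha0' hlt]]].
  exists (fun a => 0 < a < a0) (fun b => b = 1).
  + exists (mkposreal a0 ha0); simpl; intros a h h0; split; [exact h0 |].
    change (Rabs (a - 0) < a0) in h; apply Rabs_def2 in h; lra.
  + reflexivity.
  + intros a b ha ->; exists (RInt f a 1); split.
    * apply (RInt_correct (V := R_CompleteNormedModule)), gamma_ex_RInt; simpl; lra.
    * apply hP; change (Rabs (RInt f a 1 - l) < eps).
      assert (RInt f a 1 <= l) by (apply hl1; exists a; repeat split; lra).
      generalize (gamma_Chasles a a0 1) (gamma_RInt_pos a a0); intros h1 h2.
      apply Rabs_def1; generalize (cond_pos eps); lra.
Qed.

Lemma is_RInt_gen_Gamma :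
  is_RInt_gen f (at_right 0) (Rbar_locally p_infty) (Gamma x).
Proof.
destruct gamma_at_0 as [l1 [_ h1]], gamma_at_infty as [l2 [_ h2]].
generalize (is_RInt_gen_Chasles f 1 l1 l2 h1 h2); intros h.
unfold Gamma; rewrite (is_RInt_gen_unique f _ h); exact h.
Qed.

Lemma Gamma_pos : 0 < Gamma x.
Proof.
destruct gamma_at_0 as [l1 [p1 h1]], gamma_at_infty as [l2 [p2 h2]].
generalize (is_RInt_gen_Chasles f 1 l1 l2 h1 h2); intros h.
unfold Gamma; rewrite (is_RInt_gen_unique f _ h).
assert (0 < RInt f 1 2).
{ apply RInt_gt_0; [lra | intros; apply gamma_f_pos |].
  intros t ht; apply gamma_f_cont; lra. }
change (plus l1 l2) with (l1 + l2); lra.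
Qed.
End GammaPositive.

Arguments coef {I e w}.

Definition is_op_inverse {H : Hilbert} (A B : H -> H) : Prop :=
  is_linear B /\ (forall x, A (B x) = x) /\ (forall x, B (A x) = x).

Definition spectrum {H : Hilbert} (T : H -> H) (z : C) : Prop :=
  ~ exists B, is_op_inverse (fun x => minus (T x) (scal z x)) B.

(* Arbitrary when A has no bounded inverse. *)
Definition op_inv {H : Hilbert} (A : H -> H) : H -> H :=
  epsilon (inhabits (fun x => x)) (is_op_inverse A).

Definition is_adjoint {H K : Hilbert} (A : H -> K) (B : K -> H) : Prop :=
  is_linear B /\ forall x y, inner (A x) y = inner x (B y).

Definition adjoint {H K : Hilbert} (A : H -> K) : K -> H :=
  epsilon (inhabits (fun _ => zero)) (is_adjoint A).

Record unitary {H : Hilbert} (U : H -> H) : Prop := mkUnitary {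
  unitary_linear : is_linear U;
  unitary_inner : forall x y, inner (U x) (U y) = inner x y;
  unitary_surj : forall y, exists x, U x = y
}.

Lemma unitary_norm {H : Hilbert} (U : H -> H) (x : H) :
  unitary U -> norm (U x) = norm x.
Proof.
intros hU; generalize (unitary_inner U hU x x).
rewrite 2!inner_norm; intros h; apply RtoC_inj in h.
rewrite <- (sqrt_pow2 (norm (U x))), <- (sqrt_pow2 (norm x))
  by apply norm_ge_0.
f_equal; exact h.
Qed.

Lemma minus_eq0 {H : Hilbert} (x y : H) : norm (minus x y) = 0 -> x = y.
Proof.
intros h; apply (norm_eq_zero (V := H)) in h.
apply (plus_reg_r (opp y)); rewrite plus_opp_r; exact h.
Qed.

Lemma inner_ext {H : Hilbert} (x y : H) :
  (forall z, inner z x = inner z y) -> x = y.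
Proof.
intros h; apply minus_eq0; set (d := minus x y).
assert (hd : inner d d = RtoC 0).
{ unfold d at 1, minus; rewrite inner_plus_l.
  replace (opp y) with (scal (opp one : C) y) by exact (scal_opp_one (V := H) y).
  rewrite inner_scal_l.
  rewrite (inner_sym _ d x), (inner_sym _ d y), h.
  change (opp one) with (Copp (RtoC 1)); ring. }
rewrite inner_norm in hd; apply RtoC_inj in hd.
rewrite <- (sqrt_pow2 (norm d)), hd, sqrt_0 by apply norm_ge_0; reflexivity.
Qed.

Lemma unitary_adjoint {H : Hilbert} (U : H -> H) : unitary U ->
  is_adjoint U (adjoint U) /\
  (forall x, U (adjoint U x) = x) /\ (forall x, adjoint U (U x) = x).
Proof.
intros hU.
assert (inj : forall x y, U x = U y -> x = y).
{ intros x y h; apply minus_eq0; rewrite <- (unitary_norm U _ hU).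
  unfold minus; rewrite (linear_plus _ (unitary_linear U hU)).
  rewrite h, <- (linear_plus _ (unitary_linear U hU)).
  rewrite (unitary_norm U _ hU).
  exact (eq_trans (f_equal norm (plus_opp_r y)) norm_zero). }
destruct (choice _ (unitary_surj U hU)) as [V hV].
assert (hVl : is_adjoint U V).
{ split.
  - constructor.
    + intros x y; apply inj.
      rewrite (linear_plus _ (unitary_linear U hU)), !hV; reflexivity.
    + intros c x; apply inj.
      rewrite (linear_scal _ (unitary_linear U hU)), !hV; reflexivity.
    + exists 1; split; [lra |]; intros x.
      rewrite <- (unitary_norm U _ hU), hV; lra.
  - intros x y; rewrite <- (hV y) at 1; apply (unitary_inner U hU). }
assert (hA : is_adjoint U (adjoint U)).
{ unfold adjoint; apply epsilon_spec; exists V; exact hVl. }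
assert (e : forall y, adjoint U y = V y).
{ intros y; apply inner_ext; intros z.
  rewrite <- (proj2 hA), <- (proj2 hVl); reflexivity. }
split; [exact hA | split]; intros x; rewrite e; [apply hV |].
apply inj, hV.
Qed.

Definition Cexp (z : C) : C :=
  (exp (fst z) * cos (snd z), exp (fst z) * sin (snd z)).

(* Principal argument, with values in (-PI, PI]. *)
Definition Carg (z : C) : R :=
  if Rle_dec 0 (snd z) then acos (fst z / Cmod z) else - acos (fst z / Cmod z).

Definition Clog (z : C) : C := (ln (Cmod z), Carg z).

Definition expi (t : R) : C := Cexp (Cmult Ci (RtoC t)).

Record Mob := mkMob {
  mob_theta : R;
  mob_a : C;
  mob_theta_bound : - PI < mob_theta <= PI;
  mob_a_bound : Cmod mob_a < 1
}.

Definition mob_fun (phi : Mob) (z : C) : C :=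
  (expi (mob_theta phi) * (z - mob_a phi) / (1 - Cconj (mob_a phi) * z))%C.

Definition mob_id : Mob.
Proof.
refine (mkMob 0 (RtoC 0) _ _).
- generalize PI_RGT_0; lra.
- rewrite Cmod_0; lra.
Defined.

Lemma expiE (t : R) : expi t = (cos t, sin t).
Proof.
unfold expi, Cexp; simpl.
replace (0 * t - 1 * 0) with 0 by ring; replace (0 * 0 + 1 * t) with t by ring.
rewrite exp_0, !Rmult_1_l; reflexivity.
Qed.

Lemma Cmod_expi (t : R) : Cmod (expi t) = 1.
Proof.
rewrite expiE; unfold Cmod; rewrite <- !Rsqr_pow2; simpl.
rewrite Rplus_comm, sin2_cos2; apply sqrt_1.
Qed.

Definition mob_inv_theta (phi : Mob) : R :=
  if Req_EM_T (mob_theta phi) PI then PI else - mob_theta phi.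

Definition mob_inv (phi : Mob) : Mob.
Proof.
refine (mkMob (mob_inv_theta phi)
  (Copp (Cmult (expi (mob_theta phi)) (mob_a phi))) _ _).
- unfold mob_inv_theta; generalize PI_RGT_0 (mob_theta_bound phi).
  destruct (Req_EM_T (mob_theta phi) PI); lra.
- rewrite Cmod_opp, Cmod_mult, Cmod_expi, Rmult_1_l; apply mob_a_bound.
Defined.

Lemma expi_inv_theta (phi : Mob) :
  expi (mob_inv_theta phi) = Cconj (expi (mob_theta phi)).
Proof.
rewrite !expiE; unfold Cconj, mob_inv_theta; simpl.
destruct (Req_EM_T (mob_theta phi) PI) as [-> | _].
- rewrite sin_PI, Ropp_0; reflexivity.
- rewrite cos_neg, sin_neg; reflexivity.
Qed.

Lemma mob_den_neq0 (phi : Mob) (z : C) :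
  Cmod z <= 1 -> (1 - Cconj (mob_a phi) * z)%C <> RtoC 0.
Proof.
intros hz h.
assert (h1 : Cmod (Cconj (mob_a phi) * z)%C = 1).
{ replace (Cconj (mob_a phi) * z)%C with (RtoC 1).
  - rewrite Cmod_R; apply Rabs_R1.
  - symmetry; replace (Cconj (mob_a phi) * z)%C
      with (1 - (1 - Cconj (mob_a phi) * z))%C by ring.
    rewrite h; ring. }
rewrite Cmod_mult, Cmod_conj in h1.
generalize (mob_a_bound phi) (Cmod_ge_0 (mob_a phi)) (Cmod_ge_0 z); nra.
Qed.

Lemma mob_invK (phi : Mob) (z : C) :
  Cmod z <= 1 -> mob_fun (mob_inv phi) (mob_fun phi z) = z.
Proof.
intros hz; unfold mob_fun; simpl mob_theta; simpl mob_a.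
rewrite expi_inv_theta, Copp_conj, Cmult_conj.
set (u := expi (mob_theta phi)); set (a := mob_a phi).
assert (hu : (u * Cconj u)%C = RtoC 1).
{ rewrite <- Cmod2_conj; unfold u; rewrite Cmod_expi; simpl; f_equal; ring. }
generalize (mob_den_neq0 phi z hz); fold a; intros hd.
assert (ha : (1 - a * Cconj a)%C <> RtoC 0).
{ rewrite (Cmult_comm a).
  apply mob_den_neq0; left; apply mob_a_bound. }
replace (Cconj u * (u * (z - a) / (1 - Cconj a * z) - - (u * a)))%C
  with ((u * Cconj u) * ((1 - a * Cconj a) * z) / (1 - Cconj a * z))%C
  by (field; exact hd).
replace (1 - - (Cconj u * Cconj a) * (u * (z - a) / (1 - Cconj a * z)))%C
  with ((1 - Cconj a * z + (u * Cconj u) * (Cconj a * (z - a))) / (1 - Cconj a * z))%C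
  by (field; exact hd).
rewrite hu; field.
repeat split; try exact hd.
intros h; apply ha; rewrite <- h; ring.
Qed.

Definition mob_comp (phi1 phi2 phi3 : Mob) : Prop :=
  forall z, Cmod z < 1 -> mob_fun phi1 (mob_fun phi2 z) = mob_fun phi3 z.

(* The topology of Mob is that of the parameters (e^{i theta}, a). *)
Definition mob_open (U : Mob -> Prop) : Prop :=
  forall phi, U phi -> exists eps : posreal, forall psi : Mob,
    Cmod (expi (mob_theta psi) - expi (mob_theta phi))%C < eps ->
    Cmod (mob_a psi - mob_a phi)%C < eps -> U psi.

Inductive mob_borel : (Mob -> Prop) -> Prop :=
| mob_borel_open U : mob_open U -> mob_borel U
| mob_borel_compl A : mob_borel A -> mob_borel (fun phi => ~ A phi)
| mob_borel_union (A : nat -> Mob -> Prop) :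
    (forall n, mob_borel (A n)) -> mob_borel (fun phi => exists n, A n phi).

(* phi(T) = e^{i theta} (T - a) (1 - conj a T)^{-1}; the inverse exists as
   soon as the spectrum of T lies in the closed unit disc. *)
Definition mob_op {H : Hilbert} (phi : Mob) (T : H -> H) (x : H) : H :=
  let y := op_inv (fun u => minus u (scal (Cconj (mob_a phi)) (T u))) x in
  scal (expi (mob_theta phi)) (minus (T y) (scal (mob_a phi) y)).

Record homogeneous {H : Hilbert} (T : H -> H) : Prop := mkHomogeneous {
  homogeneous_linear : is_linear T;
  homogeneous_spectrum : forall z, spectrum T z -> Cmod z <= 1;
  homogeneous_equiv : forall phi : Mob, exists U : H -> H,
    unitary U /\ forall x, mob_op phi T x = adjoint U (T (U x))
}.

Record proj_unitary_rep {H : Hilbert} (pi : Mob -> H -> H) : Prop :=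
mkProjUnitaryRep {
  rep_unitary : forall phi, unitary (pi phi);
  rep_id : forall x, pi mob_id x = x;
  rep_mult : exists mult : Mob -> Mob -> C,
    (forall phi psi, Cmod (mult phi psi) = 1) /\
    forall phi psi chi, mob_comp phi psi chi ->
      forall x, pi chi x = scal (mult phi psi) (pi phi (pi psi x));
  rep_measurable : forall (x y : H) (V : C -> Prop), open V ->
    mob_borel (fun phi => V (inner (pi phi x) y))
}.

Definition associated {H : Hilbert} (pi : Mob -> H -> H) (T : H -> H) : Prop :=
  proj_unitary_rep pi /\
  forall phi x, mob_op phi T x = adjoint (pi phi) (T (pi phi x)).

Definition rep_sum {H1 H2 : Hilbert} (pi1 : Mob -> H1 -> H1)
    (pi2 : Mob -> H2 -> H2) (phi : Mob) (x : hsum H1 H2) : hsum H1 H2 :=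
  (pi1 phi (fst x), pi2 phi (snd x)).

Definition block_op {H1 H2 : Hilbert} (T1 : H1 -> H1) (S1 : H2 -> H1)
    (S2 : H1 -> H2) (T2 : H2 -> H2) (x : hsum H1 H2) : hsum H1 H2 :=
  (plus (T1 (fst x)) (S1 (snd x)), plus (S2 (fst x)) (T2 (snd x))).

Definition mob_deriv (phi : Mob) (z : C) : C := C_derive (mob_fun phi) z.

Lemma continuous_Cinv (u : C) : u <> RtoC 0 -> continuous Cinv u.
Proof.
intros hu.
assert (hn : fst u ^ 2 + snd u ^ 2 <> 0).
{ intros h; apply hu; apply injective_projections; simpl; nra. }
assert (hd : continuous (fun z : C => / (fst z ^ 2 + snd z ^ 2)) u).
{ apply (continuous_comp (fun z : C => fst z ^ 2 + snd z ^ 2) Rinv);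
    [| apply continuous_Rinv, hn].
  apply (continuous_plus (V := R_NormedModule));
    apply (continuous_comp _ (fun r : R => r ^ 2));
    try apply continuous_fst; try apply continuous_snd;
    apply (ex_derive_continuous (fun r : R => r ^ 2)); auto_derive; exact I. }
assert (h1 : continuous (fun z : C => fst (Cinv z)) u).
{ apply (continuous_mult (K := R_AbsRing) fst); [apply continuous_fst | exact hd]. }
assert (h2 : continuous (fun z : C => snd (Cinv z)) u).
{ apply (continuous_mult (K := R_AbsRing) (fun z : C => - snd z)); [| exact hd].
  apply (continuous_opp (V := R_NormedModule)), continuous_snd. }
apply (filterlim_locally (U := C_UniformSpace)); intros eps.
generalize (filter_and _ _ (proj1 (filterlim_locally _ _) h1 eps)
  (proj1 (filterlim_locally _ _) h2 eps)).
apply filter_imp; intros z [k1 k2]; split; assumption.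
Qed.

Lemma C_neq0_open (u : C) : u <> RtoC 0 -> locally u (fun z : C => z <> RtoC 0).
Proof.
intros hu.
assert (hc : continuous (fun z : C => Cmod z) u)
  by exact (filterlim_norm (V := C_NormedModule) u).
assert (hp : locally (Cmod u) (fun r => 0 < r))
  by (apply (open_gt 0), Cmod_gt_0, hu).
generalize (hc _ hp); unfold filtermap; apply filter_imp.
intros z hz; apply Cmod_gt_0, hz.
Qed.

Lemma mob_derivE (phi : Mob) (z : C) : Cmod z <= 1 ->
  mob_deriv phi z
  = (expi (mob_theta phi) * (1 - Cmod (mob_a phi) ^ 2)
     / (1 - Cconj (mob_a phi) * z) ^ 2)%C.
Proof.
intros hz; generalize (mob_den_neq0 phi z hz).
unfold mob_deriv, C_derive, mob_fun; rewrite <- RtoC_pow, Cmod2_conj.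
set (u := expi (mob_theta phi)); set (a := mob_a phi); set (b := Cconj a).
intros hd; apply is_C_lim_unique.
assert (hc : continuous (fun y : C => (1 - b * y)%C) z).
{ apply (continuous_minus (V := C_NormedModule)); [apply continuous_const |].
  apply (continuous_scal_r (V := C_NormedModule) b), continuous_id. }
assert (hi : continuous (fun y : C => (/ (1 - b * y))%C) z).
{ apply (continuous_comp (fun y : C => (1 - b * y)%C) Cinv);
    [exact hc | apply continuous_Cinv, hd]. }
assert (hg : continuous
  (fun y : C => (u * (1 - a * b) / (1 - b * z) * / (1 - b * y))%C) z).
{ apply (continuous_scal_r (V := C_NormedModule)), hi. }
replace (u * (1 - a * b) / (1 - b * z) ^ 2)%C
  with (u * (1 - a * b) / (1 - b * z) * / (1 - b * z))%C by (field; exact hd).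
assert (hne : locally z (fun y : C => (1 - b * y)%C <> RtoC 0)).
{ apply (hc _ (C_neq0_open _ hd)). }
apply (filterlim_ext_loc
  (fun y : C => (u * (1 - a * b) / (1 - b * z) * / (1 - b * y))%C)).
- unfold locally', within; generalize hne; apply filter_imp; intros y hy hyz.
  assert (y - z <> RtoC 0)%C.
  { intros h; apply hyz; eq_in C; replace y with (y - z + z)%C by (eq_in C; ring).
    rewrite h; ring. }
  eq_in C; field; repeat split; assumption.
- intros P hP; generalize (hg P hP); unfold filtermap, locally', within.
  apply filter_imp; auto.
Qed.

Definition mob_log_deriv (phi : Mob) (z : C) : C :=
  (Ci * mob_theta phi + ln (1 - Cmod (mob_a phi) ^ 2)
   - 2 * Clog (1 - Cconj (mob_a phi) * z))%C.

(* phi'(z)^{lambda/2}, for the branch of log phi' above *)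
Definition mob_deriv_pow (phi : Mob) (lambda : R) (z : C) : C :=
  Cexp (RtoC (lambda / 2) * mob_log_deriv phi z)%C.

Definition mob_deriv_abs_pow (phi : Mob) (mu : C) (z : C) : C :=
  Cexp (mu * RtoC (ln (Cmod (mob_deriv phi z))))%C.

Definition R_action (lambda : R) (mu : C) (phi : Mob) (f : C -> C) (z : C) : C :=
  (mob_deriv_pow phi lambda z * mob_deriv_abs_pow phi mu z
   * f (mob_fun phi z))%C.

(* The Hilbert space with orthogonal basis z^n (n in Z) and |z^n|^2 = w n; an
   element is the family of its Fourier coefficients. For w = 1 this is
   L^2(T). *)
Definition Hcircle (w : Z -> R) (hw : forall n, 0 < w n) : Hilbert :=
  l2_Hilbert Z Z_enum w hw.

(* f is continuous on the circle, with Fourier coefficients x. *)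
Definition is_circle_fun (x : Z -> C) (f : C -> C) : Prop :=
  (forall t : R, continuous (fun s : R => f (expi s)) t) /\
  forall n : Z,
    is_RInt (V := C_R_NormedModule)
      (fun t => f (expi t) * expi (- (IZR n * t)))%C 0 (2 * PI)
      (RtoC (2 * PI) * x n)%C.

(* The elements of the space that are continuous functions
   are dense (they include the trigonometric polynomials) and R_{lambda,mu}(phi)
   is bounded, so R_{lambda,mu} is determined by its formula on them. For the
   Complementary series the other elements need not be functions. *)
Definition is_R_rep {w : Z -> R} {hw : forall n, 0 < w n} (lambda : R) (mu : C)
    (pi : Mob -> Hcircle w hw -> Hcircle w hw) : Prop :=
  (forall phi, is_linear (pi phi)) /\
  forall (phi : Mob) (x : Hcircle w hw) (f : C -> C),
    is_circle_fun (coef x) f ->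
    is_circle_fun (coef (pi (mob_inv phi) x)) (R_action lambda mu phi f).

Definition compl_factor (lambda sigma : R) (n : Z) (k : nat) : R :=
  let s := if Z_le_dec 0 n then lambda / 2 else - (lambda / 2) in
  (INR k + s + 1 / 2 - sigma) / (INR k + s + 1 / 2 + sigma).

Fixpoint prod_lt (f : nat -> R) (n : nat) : R :=
  match n with
  | O => 1
  | S m => prod_lt f m * f m
  end.

Definition compl_weight (lambda sigma : R) (n : Z) : R :=
  prod_lt (compl_factor lambda sigma n) (Z.abs_nat n).

Lemma compl_weight_pos (lambda sigma : R) :
  0 < sigma < 1 / 2 * (1 - Rabs lambda) ->
  forall n, 0 < compl_weight lambda sigma n.
Proof.
intros hs n; unfold compl_weight; generalize (Z.abs_nat n); intros k.
induction k as [| k IH]; simpl; [lra |].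
apply Rmult_lt_0_compat; [exact IH |].
unfold compl_factor; generalize (pos_INR k) (Rle_abs lambda) (Rle_abs (- lambda)).
rewrite Rabs_Ropp; intros h1 h2 h3.
apply Rdiv_lt_0_compat; destruct (Z_le_dec 0 n); lra.
Qed.

Inductive continuous_series (lambda : R) : Type :=
| Principal (s : C) (hlambda : -1 < lambda <= 1) (hs : Re s = 0)
| Complementary (sigma : R) (hlambda : -1 < lambda < 1)
    (hsigma : 0 < sigma < 1 / 2 * (1 - Rabs lambda)).
Arguments Principal {lambda}.
Arguments Complementary {lambda}.

Definition series_mu {lambda : R} (c : continuous_series lambda) : C :=
  match c with
  | Principal s _ _ => ((1 - lambda) / 2 + s)%C
  | Complementary sigma _ _ => ((1 - lambda) / 2 + sigma)%C
  end.

Definition series_weight {lambda : R} (c : continuous_series lambda) : Z -> R :=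
  match c with
  | Principal _ _ _ => fun _ => 1
  | Complementary sigma _ _ => compl_weight lambda sigma
  end.

Lemma series_weight_pos {lambda : R} (c : continuous_series lambda) :
  forall n, 0 < series_weight c n.
Proof.
destruct c as [s hl hs | sigma hl hs]; [intros n; apply Rlt_0_1 |].
apply compl_weight_pos, hs.
Qed.

Definition series_space {lambda : R} (c : continuous_series lambda) : Hilbert :=
  Hcircle (series_weight c) (series_weight_pos c).

Definition is_P10 {lambda : R} (c : continuous_series lambda) : Prop :=
  match c with
  | Principal s _ _ => lambda = 1 /\ s = RtoC 0
  | Complementary _ _ _ => False
  end.

Definition disc_weight (nu : R) (n : nat) : R :=
  Gamma (INR n + 1) * Gamma nu / Gamma (INR n + nu).

Lemma disc_weight_pos (nu : R) : 0 < nu -> forall n, 0 < disc_weight nu n.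
Proof.
intros hnu n; unfold disc_weight; generalize (pos_INR n); intros hn.
apply Rdiv_lt_0_compat; [apply Rmult_lt_0_compat |]; apply Gamma_pos; lra.
Qed.

(* H^(nu); an element is the sequence of its Taylor coefficients at 0. *)
Definition Hdisc (nu : R) (hnu : 0 < nu) : Hilbert :=
  l2_Hilbert nat nat_enum (disc_weight nu) (disc_weight_pos nu hnu).

Definition is_disc_fun (x : nat -> C) (f : C -> C) : Prop :=
  forall z : C, Cmod z < 1 ->
    is_pseries (K := C_AbsRing) (V := C_NormedModule) x z (f z).

Definition is_Dplus_rep {nu : R} {hnu : 0 < nu}
    (pi : Mob -> Hdisc nu hnu -> Hdisc nu hnu) : Prop :=
  (forall phi, is_linear (pi phi)) /\
  forall (phi : Mob) (x : Hdisc nu hnu) (f : C -> C),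
    is_disc_fun (coef x) f ->
    is_disc_fun (coef (pi (mob_inv phi) x)) (R_action nu (RtoC 0) phi f).

(* phi^*(z) = conj (phi (conj z)), with the conjugate branch of phi'^{nu/2}. *)
Definition is_Dminus_rep {nu : R} {hnu : 0 < nu}
    (pi : Mob -> Hdisc nu hnu -> Hdisc nu hnu) : Prop :=
  (forall phi, is_linear (pi phi)) /\
  forall (phi : Mob) (x : Hdisc nu hnu) (f : C -> C),
    is_disc_fun (coef x) f ->
    is_disc_fun (coef (pi (mob_inv phi) x))
      (fun z => Cconj (mob_deriv_pow phi nu (Cconj z))
                * f (Cconj (mob_fun phi (Cconj z))))%C.

(* Main.v *)
Require Import Defs.
From Stdlib Require Import Reals ZArith ClassicalEpsilon Lra Lia Psatz.
From Coquelicot Require Import Coquelicot.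

(** Rotations make [T] raise weights by one, where [z^n] in [H1] has weight [n]
and the weights of the two discrete summands of [H2] are [>= m] and [< m]. Write
[a_n] for the weights of the shift [T1] and [b_n] for those of [S1]. Only the
matrix entries of [pi1] near the identity are needed beyond this: differentiating
[pi(phi)(T + t) = T pi(phi)(1 + tT)], [phi^{-1} = phi_{0,t}], at [t = 0] and
comparing weights gives, with [N = lambda + mu + n],
   lowering:  [a_n (mu - n - 1) + 1 = a_(n-1) (mu - n)]  if [b_(n-1) = 0],
   raising:   [a_n (N + 1) = a_(n+1) (N + a_n)]          if [b_(n+1) = 0],
and [b_n (mu - n - 1) = 0] if [b_(n-1) = 0], [b_n (N + 1) = a_(n+1) b_n] if
[b_(n+1) = 0]. Excluding [P_{1,0}] makes [mu] and [lambda + mu] non-integral.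
The third relation kills [S1] on the holomorphic summand, by induction on the
weight. There the first two leave only [a_n = 1] and [a_n = N / (n + 1 - mu)];
this dichotomy propagates downwards by the raising relation, and since it
excludes [a_(n+1) = N + 1], the last relation gives [b_n = 0] for all smaller [n]. *)

(** * Derivative of the matrix entries of the continuous series *)

(* For [phi = phi_{0,t}] and [z = e^{i th}] these are [ln |phi'(z)|] and half of
   the argument of [phi(z) / z]. *)
Definition log_ratio (t th : R) : R := ln (1 - t ^ 2) - ln (1 - 2 * t * cos th + t ^ 2).
Definition half_twist (t th : R) : R := atan (t * sin th / (1 - t * cos th)).

(** This is the real part of [1 - t e^{i th}]. It keeps that number in the right half plane, where
    the principal argument is an arctangent. *)
Lemma den_re_pos (t th : R) : -1 < t < 1 -> 0 < 1 - t * cos th.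
Proof. intros ht; generalize (COS_bound th); intros hc; destruct (Rle_lt_dec 0 t); nra. Qed.

(** The expression is [|1 - t e^{i th}|^2]. *)
Lemma den_sq_pos (t th : R) : -1 < t < 1 -> 0 < 1 - 2 * t * cos th + t ^ 2.
Proof.
intros ht; generalize (sin2_cos2 th); unfold Rsqr; intros hsc.
replace (1 - 2 * t * cos th + t ^ 2)
  with ((1 - t * cos th) ^ 2 + (t * sin th) ^ 2)
  by (replace (t ^ 2) with (t ^ 2 * (sin th * sin th + cos th * cos th))
        by (rewrite hsc; ring); ring).
generalize (pow_lt _ 2 (den_re_pos t th ht)) (pow2_ge_0 (t * sin th)); lra.
Qed.

Lemma is_derive_log_ratio (t th : R) : -1 < t < 1 ->
  is_derive (fun u => log_ratio u th) t
    (- 2 * t / (1 - t ^ 2) - (2 * t - 2 * cos th) / (1 - 2 * t * cos th + t ^ 2)).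
Proof.
intros ht; generalize (den_sq_pos t th ht); intros hd.
unfold log_ratio; auto_derive.
- repeat split; nra.
- field; split; nra.
Qed.

Lemma is_derive_half_twist (t th : R) : -1 < t < 1 ->
  is_derive (fun u => half_twist u th) t (sin th / (1 - 2 * t * cos th + t ^ 2)).
Proof.
intros ht; generalize (den_sq_pos t th ht) (den_re_pos t th ht); intros hd hr.
generalize (sin2_cos2 th); unfold Rsqr; intros hsc.
unfold half_twist; auto_derive; [lra |].
replace (1 - 2 * t * cos th + t ^ 2)
  with ((1 - t * cos th) ^ 2 + (t * sin th) ^ 2)
  by (replace (t ^ 2) with (t ^ 2 * (sin th * sin th + cos th * cos th))
        by (rewrite hsc; ring); ring).
field; split; [| lra].
assert (0 < (1 - t * cos th) ^ 2) by (apply pow_lt; exact hr).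
generalize (pow2_ge_0 (t * sin th)); lra.
Qed.

(** Differentiation under the integral sign asks for joint continuity of the derivative in [t] and
    [th]; these rules assemble it from continuity in one variable. *)
Lemma continuity_2d_pt_fst (f : R -> R) (x y : R) :
  continuous f x -> continuity_2d_pt (fun u _ => f u) x y.
Proof.
intros hf; apply (continuity_1d_2d_pt_comp f).
- apply continuity_pt_filterlim, hf.
- apply continuity_2d_pt_id1.
Qed.

Lemma continuity_2d_pt_snd (f : R -> R) (x y : R) :
  continuous f y -> continuity_2d_pt (fun _ v => f v) x y.
Proof.
intros hf; apply (continuity_1d_2d_pt_comp f).
- apply continuity_pt_filterlim, hf.
- apply continuity_2d_pt_id2.
Qed.

Lemma continuity_2d_pt_comp (f : R -> R) (g : R -> R -> R) (x y : R) :
  continuous f (g x y) -> continuity_2d_pt g x y ->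
  continuity_2d_pt (fun u v => f (g u v)) x y.
Proof.
intros hf; apply continuity_1d_2d_pt_comp, continuity_pt_filterlim, hf.
Qed.

Lemma continuity_2d_pt_div (f g : R -> R -> R) (x y : R) :
  continuity_2d_pt f x y -> continuity_2d_pt g x y -> g x y <> 0 ->
  continuity_2d_pt (fun u v => f u v / g u v) x y.
Proof.
intros hf hg h; apply continuity_2d_pt_mult; [exact hf |].
apply continuity_2d_pt_inv; assumption.
Qed.

Ltac cont_1d :=
  apply (ex_derive_continuous (K := R_AbsRing) (V := R_NormedModule));
  auto_derive; repeat split.

Lemma continuity_2d_den (t th : R) :
  continuity_2d_pt (fun u v => 1 - 2 * u * cos v + u ^ 2) t th.
Proof.
apply continuity_2d_pt_plus; [| apply (continuity_2d_pt_fst (fun u => u ^ 2)); cont_1d].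
apply continuity_2d_pt_minus; [apply continuity_2d_pt_const |].
apply continuity_2d_pt_mult; [apply (continuity_2d_pt_fst (fun u => 2 * u)) |
  apply (continuity_2d_pt_snd cos)]; cont_1d.
Qed.

Lemma continuity_2d_log_ratio (t th : R) : -1 < t < 1 ->
  continuity_2d_pt log_ratio t th.
Proof.
intros ht; apply continuity_2d_pt_minus.
- apply (continuity_2d_pt_fst (fun u => ln (1 - u ^ 2))); cont_1d; nra.
- apply (continuity_2d_pt_comp ln); [cont_1d; apply den_sq_pos, ht |].
  apply continuity_2d_den.
Qed.

Lemma continuity_2d_half_twist (t th : R) : -1 < t < 1 ->
  continuity_2d_pt half_twist t th.
Proof.
intros ht; apply (continuity_2d_pt_comp atan); [cont_1d |].
apply continuity_2d_pt_div.
- apply continuity_2d_pt_mult; [apply continuity_2d_pt_id1 |].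
  apply (continuity_2d_pt_snd sin); cont_1d.
- apply continuity_2d_pt_minus; [apply continuity_2d_pt_const |].
  apply continuity_2d_pt_mult; [apply continuity_2d_pt_id1 |].
  apply (continuity_2d_pt_snd cos); cont_1d.
- generalize (den_re_pos t th ht); lra.
Qed.

(* With [a + ib = lambda/2 + mu], [c = lambda + 2n], [d = n - p], this is the real
   part ([e = 0]) or imaginary part ([e = -PI/2]) of the integrand of the [p]-th
   Fourier coefficient of [R_{lambda,mu}(phi_{0,t}^{-1}) z^n]. *)
Definition kern (a b c d e : R) (t th : R) : R :=
  exp (a * log_ratio t th)
  * cos (b * log_ratio t th + c * half_twist t th + (d * th + e)).

Definition kern_deriv (a b c d e : R) (t th : R) : R :=
  let w' := - 2 * t / (1 - t ^ 2)
            - (2 * t - 2 * cos th) / (1 - 2 * t * cos th + t ^ 2) in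
  let p' := sin th / (1 - 2 * t * cos th + t ^ 2) in
  exp (a * log_ratio t th)
  * (a * w' * cos (b * log_ratio t th + c * half_twist t th + (d * th + e))
     - (b * w' + c * p')
       * sin (b * log_ratio t th + c * half_twist t th + (d * th + e))).

Lemma is_derive_kern (a b c d e t th : R) : -1 < t < 1 ->
  is_derive (fun u => kern a b c d e u th) t (kern_deriv a b c d e t th).
Proof.
intros ht.
generalize (is_derive_log_ratio t th ht) (is_derive_half_twist t th ht).
unfold kern, kern_deriv; cbv zeta.
set (w' := _ - _); set (p' := _ / _); intros hw hp.
auto_derive.
(* [log_ratio] and [half_twist] stay folded, so [auto_derive] asks that they be derivable and leaves
   their [Derive] in the result. *)
- repeat split; eexists; [exact hw | exact hw | exact hp].
- assert (ew : Derive (fun u : R => log_ratio u th) t = w') by exact (is_derive_unique _ _ _ hw).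
  assert (ep : Derive (fun u : R => half_twist u th) t = p') by exact (is_derive_unique _ _ _ hp).
  rewrite ew, ep; ring.
Qed.

Lemma continuity_2d_kern_deriv (a b c d e t th : R) : -1 < t < 1 ->
  continuity_2d_pt (kern_deriv a b c d e) t th.
Proof.
intros ht; unfold kern_deriv; cbv zeta.
generalize (continuity_2d_log_ratio t th ht) (continuity_2d_half_twist t th ht).
intros hw hp.
assert (hden : 1 - 2 * t * cos th + t ^ 2 <> 0) by (generalize (den_sq_pos t th ht); lra).
assert (hw' : continuity_2d_pt (fun u v => - 2 * u / (1 - u ^ 2)
            - (2 * u - 2 * cos v) / (1 - 2 * u * cos v + u ^ 2)) t th).
{ apply continuity_2d_pt_minus.
  - apply (continuity_2d_pt_fst (fun u => - 2 * u / (1 - u ^ 2))); cont_1d; nra.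
  - apply continuity_2d_pt_div; [| apply continuity_2d_den | exact hden].
    apply continuity_2d_pt_minus; [apply (continuity_2d_pt_fst (fun u => 2 * u)) |
      apply (continuity_2d_pt_snd (fun v => 2 * cos v))]; cont_1d. }
assert (hp' : continuity_2d_pt (fun u v => sin v / (1 - 2 * u * cos v + u ^ 2)) t th).
{ apply continuity_2d_pt_div; [| apply continuity_2d_den | exact hden].
  apply (continuity_2d_pt_snd sin); cont_1d. }
assert (hph : continuity_2d_pt
  (fun u v => b * log_ratio u v + c * half_twist u v + (d * v + e)) t th).
{ repeat apply continuity_2d_pt_plus; try apply continuity_2d_pt_mult;
    try apply continuity_2d_pt_const; try assumption; apply continuity_2d_pt_id2. }
apply continuity_2d_pt_mult.
- apply (continuity_2d_pt_comp exp); [cont_1d |].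
  apply continuity_2d_pt_mult; [apply continuity_2d_pt_const | exact hw].
- apply continuity_2d_pt_minus; apply continuity_2d_pt_mult.
  + apply continuity_2d_pt_mult; [apply continuity_2d_pt_const | exact hw'].
  + apply (continuity_2d_pt_comp cos); [cont_1d | exact hph].
  + apply continuity_2d_pt_plus; apply continuity_2d_pt_mult;
      try apply continuity_2d_pt_const; assumption.
  + apply (continuity_2d_pt_comp sin); [cont_1d | exact hph].
Qed.

Lemma continuous_kern (a b c d e t th : R) : -1 < t < 1 ->
  continuous (kern a b c d e t) th.
Proof.
intros ht; generalize (den_sq_pos t th ht) (den_re_pos t th ht); intros h1 h2.
unfold kern, log_ratio, half_twist; cont_1d; try nra.
Qed.

Lemma locally_lt1 (t : R) : -1 < t < 1 -> locally t (fun u => -1 < u < 1).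
Proof.
intros ht; apply (filter_and (F := locally t)); [apply (open_gt (-1)) | apply (open_lt 1)]; lra.
Qed.

Lemma ex_RInt_kern (a b c d e t : R) : -1 < t < 1 ->
  ex_RInt (kern a b c d e t) 0 (2 * PI).
Proof.
intros ht; apply (ex_RInt_continuous (V := R_CompleteNormedModule)).
intros th _; apply continuous_kern, ht.
Qed.

Lemma is_derive_RInt_kern (a b c d e : R) :
  is_derive (fun t => RInt (kern a b c d e t) 0 (2 * PI)) 0
    (RInt (kern_deriv a b c d e 0) 0 (2 * PI)).
Proof.
assert (h0 : -1 < 0 < 1) by lra.
generalize (locally_lt1 0 h0); intros hl.
rewrite <- (RInt_ext (fun th => Derive (fun u => kern a b c d e u th) 0)).
2: { intros th _; apply is_derive_unique, is_derive_kern, h0. }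
apply (is_derive_RInt_param (fun t th => kern a b c d e t th)).
- revert hl; apply filter_imp; intros t ht th _.
  eexists; apply is_derive_kern, ht.
(* The [Derive] of the kernel is known to be [kern_deriv] only in the strip [-1 < u < 1], so the two
   are exchanged on a neighbourhood of [(0, th)]. *)
- intros th _; apply (continuity_2d_pt_ext_loc (kern_deriv a b c d e)).
  + apply locally_2d_locally.
    assert (h : locally (0, th) (fun z : R * R => -1 < fst z < 1)).
    { apply (continuous_fst (U := R_UniformSpace) (V := R_UniformSpace) 0 th
        (fun u => -1 < u < 1)), hl. }
    revert h; apply filter_imp; intros [u v] hu; symmetry.
    apply is_derive_unique, is_derive_kern, hu.
  + apply continuity_2d_kern_deriv, h0.
- revert hl; apply filter_imp; intros t ht; apply ex_RInt_kern, ht.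
Qed.

Definition delta_R (n : Z) : R := if Z.eq_dec n 0 then 1 else 0.

Lemma cos_add_2PI_Z (x : R) (n : Z) : cos (x + IZR n * (2 * PI)) = cos x.
Proof.
assert (h : forall (x : R) (k : nat), cos (x + INR k * (2 * PI)) = cos x).
{ intros y k; rewrite <- (cos_period y k); f_equal; ring. }
destruct (Z_le_dec 0 n) as [hn | hn].
- rewrite <- (Z2Nat.id n hn), <- INR_IZR_INZ; apply h.
- rewrite <- (h (x + _) (Z.to_nat (- n))), INR_IZR_INZ, Z2Nat.id by lia.
  f_equal; rewrite opp_IZR; ring.
Qed.

(** Orthogonality of the characters; the phase [e] covers the cosine ([e = 0]) and the sine
    ([e = -PI/2]) at once. *)
Lemma is_RInt_cos_Z (n : Z) (e : R) :
  is_RInt (fun th => cos (IZR n * th + e)) 0 (2 * PI)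
    (2 * PI * delta_R n * cos e).
Proof.
unfold delta_R; destruct (Z.eq_dec n 0) as [-> | hn].
- apply (is_RInt_ext (fun _ => cos e)); [intros th _; f_equal; ring |].
  replace (2 * PI * 1 * cos e) with (scal (2 * PI - 0) (cos e))
    by (unfold scal; simpl; unfold mult; simpl; eq_in R; ring).
  apply (is_RInt_const (V := R_NormedModule)).
- assert (hn' : IZR n <> 0) by (apply not_0_IZR, hn).
  set (g := fun th => sin (IZR n * th + e) / IZR n).
  replace (2 * PI * 0 * cos e) with (minus (g (2 * PI)) (g 0)).
  + apply (is_RInt_derive (V := R_CompleteNormedModule) g).
    * intros th _; unfold g; auto_derive; [exact I | field; exact hn'].
    * intros th _; cont_1d.
  + unfold g, minus, plus, opp; simpl.
    replace (sin (IZR n * (2 * PI) + e)) with (sin (IZR n * 0 + e)); [ring |].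
    (* The period is moved through [sin x = cos (PI/2 - x)], which reverses its sign; hence the
       multiple [- n]. *)
    rewrite <- !cos_shift, <- (cos_add_2PI_Z (PI / 2 - (IZR n * 0 + e)) (- n)).
    f_equal; rewrite opp_IZR; ring.
Qed.

(** At [t = 0] both [log_ratio] and [half_twist] vanish and their derivatives are [2 cos th] and
    [sin th]. The product formulas then turn the integrand into waves of frequencies [d + 1] and
    [d - 1]. *)
Lemma RInt_kern_deriv0 (a b c e : R) (d : Z) :
  RInt (kern_deriv a b c (IZR d) e 0) 0 (2 * PI)
  = 2 * PI * (delta_R (d + 1) * ((a + c / 2) * cos e - b * sin e)
              + delta_R (d - 1) * ((a - c / 2) * cos e - b * sin e)).
Proof.
apply is_RInt_unique.
(* [s] shifts the frequency; the phase [e - PI/2] turns the cosine into a sine. *)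
set (X := fun s e' th => cos (IZR (d + s) * th + e')).
apply (is_RInt_ext (fun th =>
  plus (plus (scal (a + c / 2) (X 1%Z e th)) (scal (- b) (X 1%Z (e - PI / 2) th)))
       (plus (scal (a - c / 2) (X (-1)%Z e th)) (scal (- b) (X (-1)%Z (e - PI / 2) th))))).
- intros th _; unfold X, kern_deriv, log_ratio, half_twist; cbv zeta.
  replace (1 - 0 ^ 2) with 1 by ring.
  replace (1 - 2 * 0 * cos th + 0 ^ 2) with 1 by ring.
  replace (0 * sin th / (1 - 0 * cos th)) with 0 by (field; lra).
  rewrite atan_0, ln_1, !plus_IZR.
  replace (a * (0 - 0)) with 0 by ring; rewrite exp_0.
  set (P := IZR d * th + e).
  replace (b * (0 - 0) + c * 0 + P) with P by ring.
  replace ((IZR d + 1) * th + e) with (P + th) by (unfold P; ring).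
  replace ((IZR d + -1) * th + e) with (P - th) by (unfold P; ring).
  replace ((IZR d + 1) * th + (e - PI / 2)) with (- (PI / 2 - (P + th))) by (unfold P; ring).
  replace ((IZR d + -1) * th + (e - PI / 2)) with (- (PI / 2 - (P - th))) by (unfold P; ring).
  rewrite !cos_neg, !cos_shift, cos_plus, cos_minus, sin_plus, sin_minus.
  unfold plus, scal, mult; simpl; unfold mult; simpl; eq_in R; field.
- unfold X.
  replace (2 * PI * _) with
    (plus (plus (scal (a + c / 2) (2 * PI * delta_R (d + 1) * cos e))
                (scal (- b) (2 * PI * delta_R (d + 1) * cos (e - PI / 2))))
          (plus (scal (a - c / 2) (2 * PI * delta_R (d + -1) * cos e))
                (scal (- b) (2 * PI * delta_R (d + -1) * cos (e - PI / 2))))).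
  + apply (is_RInt_plus (V := R_NormedModule));
      apply (is_RInt_plus (V := R_NormedModule));
      apply (is_RInt_scal (V := R_NormedModule)); apply is_RInt_cos_Z.
  + replace (e - PI / 2) with (- (PI / 2 - e)) by ring; rewrite cos_neg, cos_shift.
    change (d - 1)%Z with (d + -1)%Z.
    unfold plus, scal, mult; simpl; unfold mult; simpl; eq_in R; field.
Qed.

Lemma RInt_kern0 (a b c e : R) (d : Z) :
  RInt (kern a b c (IZR d) e 0) 0 (2 * PI) = 2 * PI * delta_R d * cos e.
Proof.
apply is_RInt_unique.
apply (is_RInt_ext (fun th => cos (IZR d * th + e))); [| apply is_RInt_cos_Z].
intros th _; unfold kern, log_ratio, half_twist.
replace (1 - 0 ^ 2) with 1 by ring.
replace (1 - 2 * 0 * cos th + 0 ^ 2) with 1 by ring.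
replace (0 * sin th / (1 - 0 * cos th)) with 0 by (field; lra).
rewrite atan_0, ln_1.
replace (a * (0 - 0)) with 0 by ring; rewrite exp_0, Rmult_1_l; f_equal; ring.
Qed.

(** * The continuous series on the circle *)

Lemma Cconj_R (x : R) : Cconj (RtoC x) = RtoC x.
Proof. apply injective_projections; simpl; ring. Qed.

Lemma Cexp_plus (x y : C) : Cexp (x + y)%C = (Cexp x * Cexp y)%C.
Proof.
unfold Cexp; simpl; rewrite exp_plus, cos_plus, sin_plus.
apply injective_projections; simpl; ring.
Qed.

Lemma Cexp_0 : Cexp (RtoC 0) = RtoC 1.
Proof.
unfold Cexp; simpl; rewrite exp_0, cos_0, sin_0.
apply injective_projections; simpl; ring.
Qed.

Lemma expi_plus (x y : R) : expi (x + y) = (expi x * expi y)%C.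
Proof. unfold expi; rewrite <- Cexp_plus; f_equal; rewrite RtoC_plus; ring. Qed.

Lemma expi_0 : expi 0 = RtoC 1.
Proof. unfold expi; rewrite <- Cexp_0; f_equal; ring. Qed.

Lemma expi_opp (x : R) : expi (- x) = Cconj (expi x).
Proof. rewrite !expiE, cos_neg, sin_neg; reflexivity. Qed.

Lemma expi_neq0 (x : R) : expi x <> RtoC 0.
Proof. apply Cmod_gt_0; rewrite Cmod_expi; lra. Qed.

Lemma expi_pow (x : R) (k : nat) : Cpow (expi x) k = expi (INR k * x).
Proof.
induction k as [| k IH].
- simpl; rewrite Rmult_0_l, expi_0; reflexivity.
- rewrite S_INR; simpl; rewrite IH, <- expi_plus; f_equal; ring.
Qed.

(** On the circle the inverse is the conjugate, so conjugate powers serve as the negative powers of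
    [z]. *)
Definition circle_pow (n : Z) (z : C) : C :=
  if Z_le_dec 0 n then Cpow z (Z.to_nat n) else Cpow (Cconj z) (Z.to_nat (- n)).

Lemma circle_pow_expi (n : Z) (x : R) : circle_pow n (expi x) = expi (IZR n * x).
Proof.
unfold circle_pow; destruct (Z_le_dec 0 n) as [hn | hn].
- rewrite expi_pow, INR_IZR_INZ, Z2Nat.id by lia; reflexivity.
- rewrite <- expi_opp, expi_pow, INR_IZR_INZ, Z2Nat.id by lia.
  f_equal; rewrite opp_IZR; ring.
Qed.

(** In the right half plane [x / |z|] is the cosine of [atan (y / x)], and the sign test in [Carg]
    selects the sign of that angle. This makes the branch of the logarithm computable. *)
Lemma Carg_atan (x y : R) : 0 < x -> Carg (x, y) = atan (y / x).
Proof.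
intros hx; unfold Carg; simpl fst; simpl snd.
assert (hc : x / Cmod (x, y) = cos (atan (y / x))).
{ rewrite cos_atan; unfold Cmod; simpl fst; simpl snd.
  replace (x ^ 2 + y ^ 2) with (x ^ 2 * (1 + (y / x)²)) by (unfold Rsqr; field; lra).
  assert (h1 : 0 < 1 + (y / x)²) by (generalize (Rle_0_sqr (y / x)); lra).
  rewrite sqrt_mult by (first [apply pow2_ge_0 | lra]).
  rewrite sqrt_pow2 by lra.
  generalize (sqrt_lt_R0 _ h1); intros h2; field; lra. }
rewrite hc; generalize (atan_bound (y / x)) PI_RGT_0; intros hb hpi.
destruct (Rle_dec 0 y) as [hy | hy].
- apply acos_cos; split; [| lra].
  rewrite <- atan_0.
  destruct (Rle_lt_or_eq_dec _ _ hy) as [h | <-].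
  + left; apply atan_increasing, Rdiv_lt_0_compat; assumption.
  + right; f_equal; field; lra.
- rewrite <- cos_neg, acos_cos; [ring |].
  assert (atan (y / x) < atan 0); [| rewrite atan_0 in *; lra].
  apply atan_increasing.
  assert (0 < - y / x) by (apply Rdiv_lt_0_compat; lra).
  replace (y / x) with (- (- y / x)) by (field; lra); lra.
Qed.

Lemma Clog_1 : Clog (RtoC 1) = RtoC 0.
Proof.
unfold Clog; rewrite Cmod_1, ln_1; unfold RtoC; rewrite Carg_atan by lra.
replace (0 / 1) with 0 by field; rewrite atan_0; reflexivity.
Qed.

Lemma den_expi (t th : R) :
  (1 - RtoC t * expi th)%C = (1 - t * cos th, - (t * sin th)).
Proof. rewrite expiE; apply injective_projections; simpl; ring. Qed.

Lemma Cmod_den_sq (t th : R) :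
  Cmod (1 - RtoC t * expi th)%C ^ 2 = 1 - 2 * t * cos th + t ^ 2.
Proof.
rewrite den_expi, Cmod2_alt; simpl.
generalize (sin2_cos2 th); unfold Rsqr; intros h.
transitivity (1 - 2 * t * cos th + t ^ 2 * (sin th * sin th + cos th * cos th)); [ring |].
rewrite h; ring.
Qed.

Lemma ln_Cmod_den (t th : R) : -1 < t < 1 ->
  ln (Cmod (1 - RtoC t * expi th)%C) = / 2 * ln (1 - 2 * t * cos th + t ^ 2).
Proof.
intros ht; rewrite <- Cmod_den_sq, ln_pow; [simpl INR; field |].
apply Cmod_gt_0; rewrite den_expi; intros h.
injection h; generalize (den_re_pos t th ht); lra.
Qed.

Lemma Clog_den (t th : R) : -1 < t < 1 ->
  Clog (1 - RtoC t * expi th)%C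
  = (/ 2 * ln (1 - 2 * t * cos th + t ^ 2), - half_twist t th).
Proof.
intros ht; unfold Clog; rewrite ln_Cmod_den by exact ht; f_equal.
rewrite den_expi, Carg_atan by apply den_re_pos, ht.
unfold half_twist; rewrite <- atan_opp; f_equal; field.
generalize (den_re_pos t th ht); lra.
Qed.

Lemma den_polar (t th : R) : -1 < t < 1 -> exists r : R, 0 < r /\
  (1 - RtoC t * expi th)%C = (RtoC r * expi (- half_twist t th))%C.
Proof.
intros ht; generalize (den_re_pos t th ht); set (x := 1 - t * cos th); intros hx.
set (y := t * sin th).
assert (h1 : 0 < 1 + (y / x)²) by (generalize (Rle_0_sqr (y / x)); lra).
generalize (sqrt_lt_R0 _ h1); intros h2.
exists (x * sqrt (1 + (y / x)²)); split; [apply Rmult_lt_0_compat; assumption |].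
rewrite den_expi, expiE, cos_neg, sin_neg; fold x y.
unfold half_twist; fold x y; rewrite cos_atan, sin_atan.
apply injective_projections; simpl; field; lra.
Qed.

Definition mob_real (t : R) (ht : -1 < t < 1) : Mob.
Proof.
refine (mkMob 0 (RtoC t) _ _).
- generalize PI_RGT_0; lra.
- rewrite Cmod_R; apply Rabs_def1; lra.
Defined.

Definition mob_rot (th : R) (hth : - PI < th <= PI) : Mob.
Proof.
refine (mkMob th (RtoC 0) hth _); rewrite Cmod_0; lra.
Defined.

(** On the circle [z - t = z * conj (1 - t z)]. Writing [1 - t z = r e^{-i h}] with
    [h = half_twist t th], the quotient of the conjugate by the number is [e^{2 i h}]. *)
Lemma mob_fun_real (t : R) (ht : -1 < t < 1) (th : R) :
  mob_fun (mob_real t ht) (expi th) = expi (th + 2 * half_twist t th).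
Proof.
destruct (den_polar t th ht) as [r [hr er]].
unfold mob_fun; simpl mob_theta; simpl mob_a; rewrite expi_0, Cconj_R.
assert (ec : (expi th - RtoC t)%C = (expi th * (RtoC r * expi (half_twist t th)))%C).
{ generalize (f_equal Cconj er); rewrite Cminus_conj, !Cmult_conj, !Cconj_R, <- !expi_opp.
  rewrite Ropp_involutive; intros <-.
  transitivity (expi th - RtoC t * expi (th + - th))%C.
  - rewrite Rplus_opp_r, expi_0; ring.
  - rewrite expi_plus; ring. }
rewrite ec, er, expi_opp.
replace (th + 2 * half_twist t th)
  with (th + half_twist t th + half_twist t th) by ring.
rewrite !expi_plus.
assert (hu : (expi (half_twist t th) * Cconj (expi (half_twist t th)))%C = RtoC 1).
{ rewrite <- Cmod2_conj, Cmod_expi; f_equal; ring. }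
set (u := expi (half_twist t th)) in *; set (v := Cconj u) in *.
assert (hv : v <> RtoC 0) by (intros h; rewrite h in hu; apply C1_nz; rewrite <- hu; ring).
assert (hr' : RtoC r <> RtoC 0) by (intros h; apply RtoC_inj in h; lra).
transitivity (expi th * u * / v)%C; [field; split; assumption |].
replace (/ v)%C with u; [ring |].
transitivity (u * v * / v)%C; [field; exact hv | rewrite hu; field; exact hv].
Qed.

(** With [h = half_twist t th], the chosen branch is [log phi' = log_ratio t th + 2 i h]. The three
    factors contribute [lambda / 2] times this, [mu * log_ratio t th], and [i n (th + 2 h)] to the
    exponent. *)
Lemma R_action_real (lambda : R) (mu : C) (t : R) (ht : -1 < t < 1) (n : Z) (th : R) :
  R_action lambda mu (mob_real t ht) (circle_pow n) (expi th)
  = Cexp ((lambda / 2 + Re mu) * log_ratio t th,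
          Im mu * log_ratio t th + (lambda + 2 * IZR n) * half_twist t th + IZR n * th).
Proof.
unfold R_action; rewrite mob_fun_real, circle_pow_expi.
unfold mob_deriv_pow, mob_deriv_abs_pow.
unfold expi at 3; rewrite <- !Cexp_plus; f_equal.
rewrite mob_derivE by (rewrite Cmod_expi; lra).
unfold mob_log_deriv; simpl mob_theta; simpl mob_a; rewrite expi_0, Cconj_R.
rewrite Clog_den by exact ht.
rewrite Cmod_div, Cmod_mult, Cmod_1, Rmult_1_l, Cmod_pow.
2: { apply Cpow_nz; rewrite den_expi; intros h; injection h.
     generalize (den_re_pos t th ht); lra. }
rewrite Cmod_den_sq, Cmod_R.
replace (1 - RtoC (Rabs t) ^ 2)%C with (RtoC (1 - t ^ 2))
  by (rewrite <- RtoC_pow, pow2_abs, RtoC_minus; reflexivity).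
rewrite Cmod_R, (Rabs_pos_eq (1 - t ^ 2)) by nra.
rewrite pow2_abs, ln_div by (first [nra | apply den_sq_pos, ht]).
fold (log_ratio t th).
unfold log_ratio; destruct mu as [m1 m2].
apply injective_projections; simpl; field.
Qed.

Lemma mob_fun_rot (s : R) (hs : - PI < s <= PI) (z : C) :
  mob_fun (mob_rot s hs) z = (expi s * z)%C.
Proof.
unfold mob_fun; simpl mob_theta; simpl mob_a; rewrite Cconj_R.
field; intros h; apply C1_nz; rewrite <- h; ring.
Qed.

Lemma mob_deriv_pow_rot (s : R) (hs : - PI < s <= PI) (nu : R) (z : C) :
  mob_deriv_pow (mob_rot s hs) nu z = expi (s * (nu / 2)).
Proof.
unfold mob_deriv_pow, mob_log_deriv; simpl mob_theta; simpl mob_a.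
rewrite Cconj_R, Cmod_0.
replace (1 - RtoC 0 ^ 2)%C with (RtoC 1) by ring.
replace (1 - 0 * z)%C with (RtoC 1) by ring.
replace (1 - 0 ^ 2) with 1 by ring.
rewrite Clog_1, ln_1; unfold expi; f_equal.
apply injective_projections; simpl; field.
Qed.

Lemma R_action_rot (lambda : R) (mu : C) (s : R) (hs : - PI < s <= PI) (f : C -> C)
    (z : C) : Cmod z <= 1 ->
  R_action lambda mu (mob_rot s hs) f z = (expi (s * (lambda / 2)) * f (expi s * z))%C.
Proof.
intros hz; unfold R_action; rewrite mob_fun_rot, mob_deriv_pow_rot.
unfold mob_deriv_abs_pow; rewrite mob_derivE by exact hz.
simpl mob_theta; simpl mob_a; rewrite Cconj_R, Cmod_0.
replace (expi s * (1 - RtoC 0 ^ 2) / (1 - 0 * z) ^ 2)%C with (expi s)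
  by (field; intros h; apply C1_nz; rewrite <- h; ring).
rewrite Cmod_expi, ln_1, Cmult_0_r, Cexp_0; ring.
Qed.

(** * Monomials and their Fourier coefficients *)

(** The coefficient family of the [i]-th basis vector. Equality is decided classically because the
    index type is arbitrary. *)
Definition kron {I : Type} (i j : I) : C :=
  if excluded_middle_informative (j = i) then RtoC 1 else RtoC 0.

Lemma kron_same {I : Type} (i : I) : kron i i = RtoC 1.
Proof. unfold kron; destruct (excluded_middle_informative (i = i)); congruence. Qed.

Lemma kron_neq {I : Type} (i j : I) : j <> i -> kron i j = RtoC 0.
Proof. unfold kron; destruct (excluded_middle_informative (j = i)); congruence. Qed.

Lemma is_RInt_C (f : R -> C) (a b : R) (l : C) :
  is_RInt (V := C_R_NormedModule) f a b l <->
  is_RInt (fun t => Re (f t)) a b (Re l) /\ is_RInt (fun t => Im (f t)) a b (Im l).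
Proof.
split.
- intros h; split; [exact (is_RInt_fct_extend_fst _ _ _ _ h) |
    exact (is_RInt_fct_extend_snd _ _ _ _ h)].
- intros [h1 h2]; exact (is_RInt_fct_extend_pair f a b (fst l) (snd l) h1 h2).
Qed.

Lemma is_RInt_Cmult (c : C) (f : R -> C) (a b : R) (l : C) :
  is_RInt (V := C_R_NormedModule) f a b l ->
  is_RInt (V := C_R_NormedModule) (fun t => c * f t)%C a b (c * l)%C.
Proof.
rewrite !is_RInt_C; intros [h1 h2]; split.
- apply (is_RInt_minus (V := R_NormedModule));
    apply (is_RInt_scal (V := R_NormedModule)); assumption.
- apply (is_RInt_plus (V := R_NormedModule));
    apply (is_RInt_scal (V := R_NormedModule)); assumption.
Qed.

Lemma is_RInt_expi (n : Z) :
  is_RInt (V := C_R_NormedModule) (fun th => expi (IZR n * th)) 0 (2 * PI)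
    (RtoC (2 * PI * delta_R n)).
Proof.
apply is_RInt_C; split.
- apply (is_RInt_ext (fun th => cos (IZR n * th + 0))).
  + intros th _; rewrite expiE; simpl; f_equal; ring.
  + generalize (is_RInt_cos_Z n 0); rewrite cos_0, Rmult_1_r; intros h; exact h.
- apply (is_RInt_ext (fun th => cos (IZR n * th + - (PI / 2)))).
  + intros th _; rewrite expiE; simpl; rewrite <- cos_shift, <- cos_neg; f_equal; ring.
  + generalize (is_RInt_cos_Z n (- (PI / 2))); rewrite cos_neg, cos_PI2, Rmult_0_r.
    intros h; exact h.
Qed.

Lemma is_RInt_expi_shift (n p : Z) :
  is_RInt (V := C_R_NormedModule)
    (fun th => expi (IZR n * th) * expi (- (IZR p * th)))%C 0 (2 * PI)
    (RtoC (2 * PI) * kron n p)%C.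
Proof.
apply (is_RInt_ext (V := C_R_NormedModule) (fun th => expi (IZR (n - p) * th))).
{ intros th _; rewrite <- expi_plus, minus_IZR; f_equal; ring. }
replace (RtoC (2 * PI) * kron n p)%C with (RtoC (2 * PI * delta_R (n - p)));
  [apply is_RInt_expi |].
unfold delta_R; rewrite RtoC_mult; f_equal.
destruct (Z.eq_dec (n - p) 0).
- replace p with n by lia; rewrite kron_same; reflexivity.
- rewrite kron_neq by lia; reflexivity.
Qed.

Lemma circle_fun_pow (n : Z) : is_circle_fun (kron n) (circle_pow n).
Proof.
split.
- intros t; apply (continuous_ext (fun s => (cos (IZR n * s), sin (IZR n * s)) : C)).
  { intros s; rewrite circle_pow_expi, expiE; reflexivity. }
  apply (filterlim_locally (U := C_UniformSpace)); intros eps.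
  assert (h1 : continuous (fun s => cos (IZR n * s)) t) by cont_1d.
  assert (h2 : continuous (fun s => sin (IZR n * s)) t) by cont_1d.
  generalize (filter_and _ _ (proj1 (filterlim_locally _ _) h1 eps)
    (proj1 (filterlim_locally _ _) h2 eps)).
  apply filter_imp; intros s [k1 k2]; split; assumption.
- intros p; apply (is_RInt_ext (V := C_R_NormedModule)
    (fun th => expi (IZR n * th) * expi (- (IZR p * th)))%C);
    [| apply is_RInt_expi_shift].
  intros th _; rewrite circle_pow_expi; reflexivity.
Qed.

Lemma is_circle_fun_unique (x y : Z -> C) (f : C -> C) :
  is_circle_fun x f ->
  (forall p, is_RInt (V := C_R_NormedModule)
      (fun th => f (expi th) * expi (- (IZR p * th)))%C 0 (2 * PI)
      (RtoC (2 * PI) * y p)%C) ->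
  forall p, x p = y p.
Proof.
intros [_ hx] hy p.
generalize (proj1 (is_RInt_C _ _ _ _) (hx p)) (proj1 (is_RInt_C _ _ _ _) (hy p)).
intros [h1 h2] [k1 k2].
apply (is_RInt_unique (V := R_CompleteNormedModule)) in h1.
apply (is_RInt_unique (V := R_CompleteNormedModule)) in h2.
apply (is_RInt_unique (V := R_CompleteNormedModule)) in k1.
apply (is_RInt_unique (V := R_CompleteNormedModule)) in k2.
rewrite h1 in k1; rewrite h2 in k2; simpl in k1, k2.
generalize PI_RGT_0; intros hpi.
apply injective_projections; apply (Rmult_eq_reg_l (2 * PI)); unfold Re, Im in *; lra.
Qed.

(** The coefficient at [z^p] of [R_{lambda,mu}(phi_{0,t}^{-1}) z^n]. It is defined for every real
    [t], without a proof of [|t| < 1], so that it can be differentiated. *)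
Definition entry (lambda : R) (mu : C) (n p : Z) (t : R) : C :=
  let k e := kern (lambda / 2 + Re mu) (Im mu) (lambda + 2 * IZR n) (IZR (n - p)) e t in
  (RInt (k 0) 0 (2 * PI) / (2 * PI), RInt (k (- (PI / 2))) 0 (2 * PI) / (2 * PI)).

Lemma Cmult_R_div (a x y : R) : a <> 0 -> Cmult (RtoC a) (x / a, y / a) = (x, y).
Proof. intros ha; apply injective_projections; simpl; field; exact ha. Qed.

Lemma is_RInt_entry (lambda : R) (mu : C) (t : R) (ht : -1 < t < 1) (n p : Z) :
  is_RInt (V := C_R_NormedModule)
    (fun th => R_action lambda mu (mob_real t ht) (circle_pow n) (expi th)
               * expi (- (IZR p * th)))%C 0 (2 * PI)
    (RtoC (2 * PI) * entry lambda mu n p t)%C.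
Proof.
generalize PI_RGT_0; intros hpi.
unfold entry; cbv zeta; rewrite Cmult_R_div by lra.
set (k := fun e => kern (lambda / 2 + Re mu) (Im mu) (lambda + 2 * IZR n) (IZR (n - p)) e t).
apply is_RInt_C; split.
- apply (is_RInt_ext (k 0));
    [| apply (RInt_correct (V := R_CompleteNormedModule)), ex_RInt_kern, ht].
  intros th _; rewrite R_action_real; unfold expi; rewrite <- Cexp_plus.
  unfold k, kern, Cexp; simpl; rewrite minus_IZR; f_equal; f_equal; ring.
- apply (is_RInt_ext (k (- (PI / 2))));
    [| apply (RInt_correct (V := R_CompleteNormedModule)), ex_RInt_kern, ht].
  intros th _; rewrite R_action_real; unfold expi; rewrite <- Cexp_plus.
  unfold k, kern, Cexp; simpl; rewrite minus_IZR; f_equal; [f_equal; ring |].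
  rewrite <- cos_shift, <- cos_neg; f_equal; ring.
Qed.

(** * First-order expansions at the identity *)

(** The expansion [c t = d + t D + o(t)] in the real parameter [t], taken componentwise. The value
    is recorded with the derivative because the product rule needs it. *)
Definition tangent (c : R -> C) (d D : C) : Prop :=
  c 0 = d /\ is_derive (fun t => Re (c t)) 0 (Re D)
  /\ is_derive (fun t => Im (c t)) 0 (Im D).

Lemma tangent_unique (c1 c2 : R -> C) (d1 d2 D1 D2 : C) :
  tangent c1 d1 D1 -> tangent c2 d2 D2 ->
  (forall t, -1 < t < 1 -> c1 t = c2 t) -> d1 = d2 /\ D1 = D2.
Proof.
intros [<- [h1 k1]] [<- [h2 k2]] h.
split; [apply h; lra |].
assert (hl : locally 0 (fun t => c2 t = c1 t)).
{ assert (h0 : -1 < 0 < 1) by lra.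
  generalize (locally_lt1 0 h0); apply filter_imp; intros t ht; symmetry; apply h, ht. }
assert (h3 : is_derive (fun t => Re (c1 t)) 0 (Re D2)).
{ apply (is_derive_ext_loc (K := R_AbsRing) (V := R_NormedModule)) with (2 := h2).
  revert hl; apply filter_imp; intros t ->; reflexivity. }
assert (k3 : is_derive (fun t => Im (c1 t)) 0 (Im D2)).
{ apply (is_derive_ext_loc (K := R_AbsRing) (V := R_NormedModule)) with (2 := k2).
  revert hl; apply filter_imp; intros t ->; reflexivity. }
apply is_derive_unique in h1; apply is_derive_unique in h3.
apply is_derive_unique in k1; apply is_derive_unique in k3.
apply injective_projections; unfold Re, Im in *; congruence.
Qed.

Lemma tangent_plus (c1 c2 : R -> C) (d1 d2 D1 D2 : C) :
  tangent c1 d1 D1 -> tangent c2 d2 D2 ->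
  tangent (fun t => c1 t + c2 t)%C (d1 + d2)%C (D1 + D2)%C.
Proof.
intros [<- [h1 k1]] [<- [h2 k2]]; split; [reflexivity | split].
- exact (is_derive_plus (K := R_AbsRing) (V := R_NormedModule) _ _ _ _ _ h1 h2).
- exact (is_derive_plus (K := R_AbsRing) (V := R_NormedModule) _ _ _ _ _ k1 k2).
Qed.

Lemma tangent_scal (a : C) (c : R -> C) (d D : C) :
  tangent c d D -> tangent (fun t => a * c t)%C (a * d)%C (a * D)%C.
Proof.
intros [<- [h k]]; split; [reflexivity | split].
- exact (is_derive_minus (K := R_AbsRing) (V := R_NormedModule) _ _ _ _ _
    (is_derive_scal _ _ (Re a) _ h) (is_derive_scal _ _ (Im a) _ k)).
- exact (is_derive_plus (K := R_AbsRing) (V := R_NormedModule) _ _ _ _ _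
    (is_derive_scal _ _ (Re a) _ k) (is_derive_scal _ _ (Im a) _ h)).
Qed.

(** The factor [t] vanishes at 0, so the product rule keeps only the value of [c]. *)
Lemma tangent_id_mult (c : R -> C) (d D : C) :
  tangent c d D -> tangent (fun t => RtoC t * c t)%C (RtoC 0) d.
Proof.
intros [<- [h k]]; split; [apply injective_projections; simpl; ring | split].
- apply (is_derive_ext (fun t => t * Re (c t))).
  { intros t; unfold Re; simpl; eq_in R; ring. }
  replace (Re (c 0)) with (1 * Re (c 0) + 0 * Re D) by ring.
  apply (is_derive_mult (K := R_AbsRing) (fun t => t) (fun t => Re (c t)) 0 1 (Re D));
    [apply (is_derive_id (K := R_AbsRing)) | exact h | exact Rmult_comm].
- apply (is_derive_ext (fun t => t * Im (c t))).
  { intros t; unfold Im; simpl; eq_in R; ring. }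
  replace (Im (c 0)) with (1 * Im (c 0) + 0 * Im D) by ring.
  apply (is_derive_mult (K := R_AbsRing) (fun t => t) (fun t => Im (c t)) 0 1 (Im D));
    [apply (is_derive_id (K := R_AbsRing)) | exact k | exact Rmult_comm].
Qed.

Lemma delta_R_kron (n p : Z) : RtoC (delta_R (n - p)) = kron n p.
Proof.
unfold delta_R; destruct (Z.eq_dec (n - p) 0).
- replace p with n by lia; rewrite kron_same; reflexivity.
- rewrite kron_neq by lia; reflexivity.
Qed.

(** The infinitesimal action sends [z^n] to [(lambda + mu + n) z^{n+1} + (mu - n) z^{n-1}]. This is
    [RInt_kern_deriv0] with [d = n - p]: there [a + c/2] and [a - c/2] are the real parts of the two
    coefficients and [b] is their common imaginary part. *)
Lemma tangent_entry (lambda : R) (mu : C) (n p : Z) :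
  tangent (entry lambda mu n p) (kron n p)
    (kron (n + 1)%Z p * (lambda + mu + IZR n) + kron (n - 1)%Z p * (mu - IZR n))%C.
Proof.
generalize PI_RGT_0; intros hpi.
assert (hd : forall a b c e : R,
  is_derive (fun t => RInt (kern a b c (IZR (n - p)) e t) 0 (2 * PI) / (2 * PI)) 0
    (delta_R (n - p + 1) * ((a + c / 2) * cos e - b * sin e)
     + delta_R (n - p - 1) * ((a - c / 2) * cos e - b * sin e))).
{ intros a b c e.
  generalize (is_derive_scal _ _ (/ (2 * PI)) _ (is_derive_RInt_kern a b c (IZR (n - p)) e)).
  rewrite RInt_kern_deriv0; intros h.
  replace (delta_R (n - p + 1) * ((a + c / 2) * cos e - b * sin e) + _) with
    (/ (2 * PI) * (2 * PI * (delta_R (n - p + 1) * ((a + c / 2) * cos e - b * sin e)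
     + delta_R (n - p - 1) * ((a - c / 2) * cos e - b * sin e)))) by (field; lra).
  revert h; apply is_derive_ext; intros t; unfold Rdiv; apply Rmult_comm. }
unfold entry; split; [| split]; cbv zeta.
- rewrite !RInt_kern0, cos_0, cos_neg, cos_PI2, <- delta_R_kron.
  apply injective_projections; simpl; field; lra.
- generalize (hd (lambda / 2 + Re mu) (Im mu) (lambda + 2 * IZR n) 0); intros h.
  refine (eq_ind _ (fun l : R => is_derive _ 0 l) h _ _).
  rewrite <- !delta_R_kron, cos_0, sin_0.
  replace (n + 1 - p)%Z with (n - p + 1)%Z by ring.
  replace (n - 1 - p)%Z with (n - p - 1)%Z by ring.
  destruct mu as [m1 m2]; simpl; field.
- generalize (hd (lambda / 2 + Re mu) (Im mu) (lambda + 2 * IZR n) (- (PI / 2))); intros h.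
  refine (eq_ind _ (fun l : R => is_derive _ 0 l) h _ _).
  rewrite <- !delta_R_kron, cos_neg, sin_neg, cos_PI2, sin_PI2.
  replace (n + 1 - p)%Z with (n - p + 1)%Z by ring.
  replace (n - 1 - p)%Z with (n - p - 1)%Z by ring.
  destruct mu as [m1 m2]; simpl; ring.
Qed.

(** * Basis vectors *)

Lemma is_series_single {K : AbsRing} {V : NormedModule K} (u : nat -> V) (k0 : nat) :
  (forall k, k <> k0 -> u k = zero) -> is_series u (u k0).
Proof.
intros hu.
assert (h : forall n, sum_n u n = if le_lt_dec k0 n then u k0 else zero).
{ induction n as [| n IH].
  - rewrite sum_O; destruct (le_lt_dec k0 0) as [h | h];
      [f_equal; lia | apply hu; lia].
  - rewrite sum_Sn, IH.
    destruct (le_lt_dec k0 n), (le_lt_dec k0 (S n)); try lia.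
    + rewrite (hu (S n)) by lia; apply plus_zero_r.
    + replace k0 with (S n) by lia; apply plus_zero_l.
    + rewrite (hu (S n)) by lia; apply plus_zero_l. }
apply (filterlim_ext_loc (fun _ => u k0)); [| apply filterlim_const].
exists k0; intros n hn; rewrite h; destruct (le_lt_dec k0 n); [reflexivity | lia].
Qed.

Lemma basis_summable {I : Type} (e : enumeration I) (w : I -> R) (i : I) :
  ex_series (fun k => w (e k) * Cmod (kron i (e k)) ^ 2).
Proof.
destruct (enum_surj _ e i) as [k0 <-].
exists (w (e k0) * Cmod (kron (e k0) (e k0)) ^ 2).
apply (is_series_single (V := R_NormedModule)
  (fun k => w (e k) * Cmod (kron (e k0) (e k)) ^ 2)).
intros k hk; rewrite kron_neq, Cmod_0; [change zero with 0; eq_in R; ring |].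
intros h; apply hk, (enum_inj _ e), h.
Qed.

Definition basis {I : Type} {e : enumeration I} {w : I -> R}
    {hw : forall i, 0 < w i} (i : I) : l2_Hilbert I e w hw :=
  mkL2 I e w (kron i) (basis_summable e w i).

(** * Weighted l2 spaces *)

Section L2Basis.
Context {I : Type} {e : enumeration I} {w : I -> R} {hw : forall i, 0 < w i}.
Notation H := (l2_Hilbert I e w hw).
Notation CV := (AbsRing_NormedModule C_AbsRing).

Lemma coef_scal (c : C) (x : H) (i : I) : coef (scal c x : H) i = (c * coef x i)%C.
Proof. reflexivity. Qed.

Lemma coef_plus (x y : H) (i : I) : coef (plus x y : H) i = (coef x i + coef y i)%C.
Proof. reflexivity. Qed.

Lemma coef_basis (i j : I) : coef (basis i : H) j = kron i j.
Proof. reflexivity. Qed.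

(** [is_linear] includes boundedness; the constant comes from [w_i |x_i|^2 <= |x|^2]. *)
Lemma is_linear_coef (i : I) :
  is_linear (U := H) (V := CV) (fun x : H => coef x i).
Proof.
constructor; [reflexivity | reflexivity |].
exists (/ sqrt (w i)).
assert (hs : 0 < sqrt (w i)) by apply sqrt_lt_R0, hw.
split; [apply Rinv_0_lt_compat, hs |]; intros x.
destruct (enum_surj _ e i) as [k <-].
change (Cmod (coef x (e k)) <= / sqrt (w (e k)) * l2_norm I e w x).
apply (Rmult_le_reg_l (sqrt (w (e k)))); [exact hs |].
rewrite <- Rmult_assoc, Rinv_r, Rmult_1_l by lra.
apply pow2_le; [| apply l2_norm_pos].
rewrite Rpow_mult_distr, pow2_sqrt by (left; apply hw).
apply coef_le, hw.
Qed.

(** The tail of [x] beyond the first [n] indices of the enumeration, built as a finite combination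
    so that a linear functional can be evaluated on it. *)
Fixpoint remainder (x : H) (n : nat) : H :=
  match n with
  | O => x
  | S m => plus (remainder x m) (scal (Copp (coef x (e m))) (basis (e m)))
  end.

Lemma coef_remainder (x : H) (n k : nat) :
  coef (remainder x n) (e k) = if le_lt_dec n k then coef x (e k) else RtoC 0.
Proof.
induction n as [| n IH]; [destruct (le_lt_dec 0 k); [reflexivity | lia] |].
simpl remainder; rewrite coef_plus, coef_scal, coef_basis, IH.
destruct (Nat.eq_dec k n) as [-> | hk].
- rewrite kron_same.
  destruct (le_lt_dec n n), (le_lt_dec (S n) n); try lia; ring.
- rewrite kron_neq by (intros h; apply hk, (enum_inj _ e), h).
  destruct (le_lt_dec n k), (le_lt_dec (S n) k); try lia; ring.
Qed.

Lemma norm_remainder (x : H) (n : nat) :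
  norm (remainder x (S n)) ^ 2
  = norm x ^ 2 - sum_n (fun k => w (e k) * Cmod (coef x (e k)) ^ 2) n.
Proof.
change (l2_norm I e w (remainder x (S n)) ^ 2
  = l2_norm I e w x ^ 2 - sum_n (fun k => w (e k) * Cmod (coef x (e k)) ^ 2) n).
rewrite !l2_norm_sq by exact hw.
rewrite (Series_incr_n _ (S n)); [| lia | apply coef_summable].
rewrite (Series_incr_n (fun k => w (e k) * Cmod (coef x (e k)) ^ 2) (S n));
  [| lia | apply coef_summable].
simpl pred; rewrite sum_n_Reals.
rewrite (sum_eq _ (fun _ => 0)), sum_cte.
2: { intros k hk; rewrite coef_remainder.
     destruct (le_lt_dec (S n) k); [lia |]; rewrite Cmod_0; ring. }
rewrite (Series_ext _ (fun k => w (e (S n + k)%nat) * Cmod (coef x (e (S n + k)%nat)) ^ 2)).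
2: { intros k; rewrite coef_remainder.
     destruct (le_lt_dec (S n) (S n + k)); [reflexivity | lia]. }
ring.
Qed.

(** Finite combinations of basis vectors are dense: [L x = L (remainder x n)] for every [n], and the
    norm of the remainder tends to 0 while [L] is bounded. *)
Lemma functional_zero (L : H -> C) : is_linear (U := H) (V := CV) L ->
  (forall i, L (basis i) = RtoC 0) -> forall x, L x = RtoC 0.
Proof.
intros hL h0 x; destruct (linear_norm _ hL) as [M [hM hb]].
assert (hr : forall n, L (remainder x n) = L x).
{ induction n as [| n IH]; [reflexivity |].
  simpl remainder; rewrite (linear_plus _ hL), (linear_scal _ hL), h0, IH.
  change (L x + - coef x (e n) * 0 = L x)%C; ring. }
apply Cmod_eq_0; destruct (Rle_lt_or_eq_dec _ _ (Cmod_ge_0 (L x))) as [hp | he]; [| auto].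
exfalso.
(* A remainder of squared norm below this value would violate
   [|L x| <= M * norm (remainder x (S n))]. *)
set (eps := (Cmod (L x) / M) ^ 2).
assert (heps : 0 < eps) by (apply pow_lt, Rdiv_lt_0_compat; assumption).
set (u := fun k => w (e k) * Cmod (coef x (e k)) ^ 2).
assert (hs : is_lim_seq (sum_n u) (Series u))
  by exact (Series_correct u (coef_summable I e w x)).
apply is_lim_seq_spec in hs; destruct (hs (mkposreal eps heps)) as [n hn].
specialize (hn n (Nat.le_refl n)); simpl pos in hn.
generalize (norm_remainder x n) (hb (remainder x (S n))); rewrite hr.
change (norm (L x)) with (Cmod (L x)); intros h1 h2.
change (norm x) with (l2_norm I e w x) in h1.
rewrite (l2_norm_sq I e w hw) in h1; fold u in h1.
apply Rabs_def2 in hn.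
assert (h3 : norm (remainder x (S n)) ^ 2 < eps) by (rewrite h1; lra).
assert (h4 : Cmod (L x) / M <= norm (remainder x (S n))).
{ apply (Rmult_le_reg_l M); [exact hM |].
  replace (M * (Cmod (L x) / M)) with (Cmod (L x)) by (field; lra); exact h2. }
assert (h5 : eps <= norm (remainder x (S n)) ^ 2).
{ apply pow_incr; split; [left; apply Rdiv_lt_0_compat; assumption | exact h4]. }
lra.
Qed.

Lemma inner_basis (x : H) (i : I) : inner x (basis i) = (RtoC (w i) * coef x i)%C.
Proof.
destruct (enum_surj _ e i) as [k0 <-].
set (u := fun (g : C -> R) k => w (e k) * g (coef x (e k) * Cconj (kron (e k0) (e k)))%C).
change ((Series (u Re), Series (u Im)) = (RtoC (w (e k0)) * coef x (e k0))%C).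
assert (hu : forall g, g (RtoC 0) = 0 -> Series (u g) = u g k0).
{ intros g hg; apply is_series_unique, (is_series_single (V := R_NormedModule)).
  intros k hk; unfold u.
  rewrite kron_neq by (intros h; apply hk, (enum_inj _ e), h).
  rewrite Cconj_R, Cmult_0_r, hg; apply Rmult_0_r. }
rewrite !hu by reflexivity; unfold u; rewrite kron_same, Cconj_R.
apply injective_projections; simpl; ring.
Qed.

(** Pairing [U x] with [U (basis p) = v * basis p] gives [conj v * (U x)_p = x_p] once [w p] is
    cancelled, and [v] is unimodular. *)
Lemma coef_isometry_eigen (U : H -> H) (p : I) (v : C) :
  (forall x y, inner (U x) (U y) = inner x y) ->
  U (basis p) = scal v (basis p) -> Cmod v = 1 ->
  forall x, coef (U x) p = (v * coef x p)%C.
Proof.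
intros hU hp hv x.
assert (hvv : (v * Cconj v)%C = RtoC 1) by (rewrite <- Cmod2_conj, hv; f_equal; ring).
generalize (hU x (basis p)); rewrite hp, inner_sym, inner_scal_l, Cmult_conj.
rewrite <- inner_sym, !inner_basis; intros h.
assert (hw0 : RtoC (w p) <> RtoC 0)
  by (intros h0; apply RtoC_inj in h0; generalize (hw p); lra).
transitivity (v * (Cconj v * (RtoC (w p) * coef (U x) p)) / RtoC (w p))%C.
- transitivity ((v * Cconj v) * coef (U x) p)%C; [rewrite hvv; ring | field; exact hw0].
- rewrite h; field; exact hw0.
Qed.
End L2Basis.

Section L2Operators.
Context {I J : Type} {e : enumeration I} {e' : enumeration J}
  {w : I -> R} {w' : J -> R} {hw : forall i, 0 < w i} {hw' : forall i, 0 < w' i}.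
Notation H := (l2_Hilbert I e w hw).
Notation K := (l2_Hilbert J e' w' hw').
Notation CV := (AbsRing_NormedModule C_AbsRing).

Lemma linear_coef_zero (F : H -> K) (p : J) : is_linear F ->
  (forall i, coef (F (basis i)) p = RtoC 0) -> forall x, coef (F x) p = RtoC 0.
Proof.
intros hF h; apply (functional_zero (fun x => coef (F x) p)); [| exact h].
exact (is_linear_comp (W := CV) F (fun y : K => coef y p) hF (is_linear_coef p)).
Qed.

(** The bounded functional [y -> (F y)_p - a y_q] kills every basis vector, so [functional_zero]
    applies. *)
Lemma linear_coef_single (F : H -> K) (q : I) (p : J) : is_linear F ->
  (forall i, i <> q -> coef (F (basis i)) p = RtoC 0) ->
  forall x, coef (F x) p = (coef (F (basis q)) p * coef x q)%C.
Proof.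
intros hF h x; set (a := coef (F (basis q)) p).
assert (hz : (coef (F x) p + - a * coef x q)%C = RtoC 0).
{ apply (functional_zero (fun y => (coef (F y) p + - a * coef y q)%C)).
  - apply (is_linear_comp (U := H) (V := prod_NormedModule C_AbsRing CV CV) (W := CV)
      (fun y => (coef (F y) p, (- a * coef y q)%C)) (fun t => plus (fst t) (snd t)));
      [| apply is_linear_plus].
    apply (is_linear_prod (T := H) (U := CV) (V := CV)).
    + exact (is_linear_comp (W := CV) F (fun y : K => coef y p) hF (is_linear_coef p)).
    + apply (is_linear_comp (U := H) (V := CV) (W := CV) (fun y => coef y q)
        (fun z : CV => scal (Copp a : C_AbsRing) z)); [apply is_linear_coef |].
      apply is_linear_scal_r; exact Cmult_comm.
  - intros i; destruct (excluded_middle_informative (i = q)) as [-> | hi].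
    + rewrite coef_basis, kron_same; fold a; ring.
    + rewrite h by exact hi; rewrite coef_basis, kron_neq by auto; ring. }
transitivity (coef (F x) p + - a * coef x q + a * coef x q)%C; [ring | rewrite hz; ring].
Qed.

(** The coefficients at [p] of the two sides of the intertwining relation are [s * v] and [u] times
    the same number, which must vanish when [s * v] and [u] differ. *)
Lemma coef_zero_of_weights (F : H -> K) (U : H -> H) (V : K -> K) (i : I) (p : J)
    (s u v : C) :
  is_linear F ->
  (forall x y, inner (V x) (V y) = inner x y) ->
  U (basis i) = scal u (basis i) -> V (basis p) = scal v (basis p) -> Cmod v = 1 ->
  V (scal s (F (basis i))) = F (U (basis i)) -> (s * v)%C <> u ->
  coef (F (basis i)) p = RtoC 0.
Proof.
intros hF hV hu hv hv1 hrel hne.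
generalize (f_equal (fun y => coef y p) hrel); cbv beta.
rewrite hu, (linear_scal _ hF).
rewrite (coef_isometry_eigen V p v hV hv hv1), !coef_scal; intros h.
assert (hd : (s * v - u)%C <> RtoC 0).
{ intros h0; apply hne; transitivity (s * v - u + u)%C; [ring | rewrite h0; ring]. }
set (y := coef (F (basis i)) p) in *.
transitivity ((v * (s * y) - u * y) / (s * v - u))%C; [field; exact hd |].
replace (v * (s * y))%C with (u * y)%C by (symmetry; exact h); field; exact hd.
Qed.
End L2Operators.

(** * The intertwining relation *)

(** Turns [1 - conj a T] into a multiple of [T - 1 / conj a], the form in which the spectrum is
    defined. *)
Lemma scal_minus_inv {V : NormedModule C_AbsRing} (c : C) (x y : V) :
  c <> RtoC 0 -> minus x (scal c y) = scal (Copp c) (minus y (scal (Cinv c) x)).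
Proof.
intros hc.
rewrite (scal_minus_distr_l (V := V) (Copp c : C_AbsRing) y).
rewrite (scal_assoc (V := V) (Copp c : C_AbsRing) (Cinv c)).
replace (mult (Copp c : C_AbsRing) (Cinv c)) with (opp (one : C_AbsRing))
  by (change (Copp (RtoC 1) = (- c * / c)%C); field; exact hc).
rewrite (scal_opp_one (V := V)).
change (Copp c) with (opp (c : C_AbsRing)); rewrite (scal_opp_l (V := V)).
unfold minus; rewrite opp_opp; apply plus_comm.
Qed.

Lemma scal_cancel {V : NormedModule C_AbsRing} (b c : C) (x : V) :
  (b * c)%C = RtoC 1 -> scal b (scal c x) = x.
Proof.
intros h; rewrite (scal_assoc (V := V) (b : C_AbsRing) c).
replace (mult (b : C_AbsRing) c) with (one : C_AbsRing) by (symmetry; exact h).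
apply scal_one.
Qed.

(** Evaluating [phi(T)] at [(1 - conj a T) y] removes the inverse, and applying [pi phi] removes the
    adjoint. *)
Lemma mob_intertwining {H : Hilbert} (pi : Mob -> H -> H) (T : H -> H) :
  homogeneous T -> associated pi T ->
  forall (phi : Mob) (y : H),
    pi phi (scal (expi (mob_theta phi)) (minus (T y) (scal (mob_a phi) y)))
    = T (pi phi (minus y (scal (Cconj (mob_a phi)) (T y)))).
Proof.
intros hT [hpi hrel] phi y.
set (a := mob_a phi).
set (A := (fun u => minus u (scal (Cconj a) (T u))) : H -> H).
assert (hinv : exists B, is_op_inverse A B).
{ destruct (Ceq_dec a (RtoC 0)) as [h0 | h0].
  - exists (fun x => x).
    assert (hA : forall x, A x = x).
    { intros x; unfold A; rewrite h0, Cconj_R.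
      transitivity (minus x (zero : H)); [f_equal; apply (scal_zero_l (V := H)) |].
      exact (minus_zero_r (G := H) x). }
    split; [apply is_linear_id | split; intros x; apply hA].
  - assert (hb0 : Cconj a <> RtoC 0).
    { intros h; apply h0; rewrite <- (Cconj_conj a), h; apply Cconj_R. }
    (* The point [1 / conj a] has modulus larger than 1, hence lies outside the spectrum of a
       homogeneous operator. *)
    assert (hsp : ~ spectrum T (/ Cconj a)%C).
    { intros hs; apply (homogeneous_spectrum T hT) in hs.
      rewrite Cmod_inv, Cmod_conj in hs by exact hb0.
      assert (ha : 0 < Cmod a) by (apply Cmod_gt_0, h0).
      generalize (mob_a_bound phi); fold a; intros hlt.
      apply (Rmult_le_compat_l (Cmod a)) in hs; [| lra].
      rewrite Rinv_r in hs; lra. }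
    apply NNPP in hsp; destruct hsp as [B [hB [h1 h2]]].
    (* [A] is [- conj a] times [T - 1 / conj a], so its inverse is [B] after multiplication by the
       inverse scalar [b]. *)
    set (b := (- / Cconj a)%C).
    assert (e1 : forall x, A x = scal (- Cconj a)%C (minus (T x) (scal (/ Cconj a)%C x))).
    { intros x; exact (scal_minus_inv (V := H) (Cconj a) x (T x) hb0). }
    exists (fun x => B (scal b x)); split; [| split].
    + apply (is_linear_comp (U := H) (V := H) (W := H) (fun x : H => scal b x) B); [| exact hB].
      exact (is_linear_scal_r (K := C_AbsRing) (V := H) b Cmult_comm).
    + intros x; rewrite e1, h1; apply (scal_cancel (V := H)); unfold b; field; exact hb0.
    + intros x; rewrite e1; etransitivity; [| exact (h2 x)]; f_equal.
      apply (scal_cancel (V := H)); unfold b; field; exact hb0. }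
assert (hop : is_op_inverse A (op_inv A)) by (unfold op_inv; apply epsilon_spec, hinv).
destruct hop as [_ [_ h3]].
generalize (hrel phi (A y)); unfold mob_op; cbv zeta; fold a.
change (fun u : H => minus u (scal (Cconj a) (T u))) with A.
rewrite h3; intros h4.
destruct (unitary_adjoint (pi phi) (rep_unitary pi hpi phi)) as [_ [h5 _]].
rewrite h4; apply h5.
Qed.

(** * The representations on monomials *)

Lemma is_series_Re (u : nat -> C) (l : C) :
  is_series (K := C_AbsRing) (V := C_NormedModule) u l ->
  is_series (fun k => Re (u k)) (Re l).
Proof.
intros h.
assert (hs : forall n, sum_n (fun k => Re (u k)) n
  = Re (sum_n (G := C_AbelianMonoid) u n)).
{ induction n as [| n IH]; [rewrite !sum_O; reflexivity |].
  rewrite !sum_Sn, IH; reflexivity. }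
apply (filterlim_ext (fun n => Re (sum_n (G := C_AbelianMonoid) u n)));
  [intros n; symmetry; apply hs |].
apply (filterlim_comp _ _ _ _ Re _ _ _ h).
destruct l as [l1 l2]; exact (continuous_fst (U := R_UniformSpace) (V := R_UniformSpace) l1 l2).
Qed.

Lemma is_series_Im (u : nat -> C) (l : C) :
  is_series (K := C_AbsRing) (V := C_NormedModule) u l ->
  is_series (fun k => Im (u k)) (Im l).
Proof.
intros h.
assert (hs : forall n, sum_n (fun k => Im (u k)) n
  = Im (sum_n (G := C_AbelianMonoid) u n)).
{ induction n as [| n IH]; [rewrite !sum_O; reflexivity |].
  rewrite !sum_Sn, IH; reflexivity. }
apply (filterlim_ext (fun n => Im (sum_n (G := C_AbelianMonoid) u n)));
  [intros n; symmetry; apply hs |].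
apply (filterlim_comp _ _ _ _ Im _ _ _ h).
destruct l as [l1 l2]; exact (continuous_snd (U := R_UniformSpace) (V := R_UniformSpace) l1 l2).
Qed.

(** If the radius were at most 0, the point 1/2 would lie outside the disc of convergence, where the
    terms cannot tend to 0. *)
Lemma CV_radius_pos (a : nat -> R) : ex_pseries a (1 / 2) -> Rbar_lt 0 (CV_radius a).
Proof.
intros h; apply Rbar_not_le_lt; intros hle.
assert (hlt : Rbar_lt (CV_radius a) (Rabs (1 / 2))).
{ apply Rbar_le_lt_trans with (1 := hle); simpl; rewrite Rabs_pos_eq; lra. }
apply (CV_disk_outside a (1 / 2) hlt).
apply ex_series_lim_0 in h.
revert h; apply is_lim_seq_ext; intros n.
rewrite pow_n_pow; apply Rmult_comm.
Qed.

Lemma real_pseries_unique (a b : nat -> R) (f : R -> R) :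
  (forall r, Rabs r < 1 -> is_pseries a r (f r)) ->
  (forall r, Rabs r < 1 -> is_pseries b r (f r)) -> forall n, a n = b n.
Proof.
intros ha hb n.
assert (hh : Rabs (1 / 2) < 1) by (rewrite Rabs_pos_eq; lra).
apply PSeries_ext_recip.
- apply CV_radius_pos; eexists; apply ha, hh.
- apply CV_radius_pos; eexists; apply hb, hh.
- exists (mkposreal 1 Rlt_0_1); intros r hr.
  assert (hr' : Rabs r < 1).
  { change (Rabs (r - 0) < 1) in hr; rewrite Rminus_0_r in hr; exact hr. }
  rewrite (is_pseries_unique _ _ _ (ha r hr')), (is_pseries_unique _ _ _ (hb r hr')).
  reflexivity.
Qed.

Lemma pow_n_C (z : C) (n : nat) : pow_n (K := C_Ring) z n = Cpow z n.
Proof. induction n as [| n IH]; [reflexivity |]; simpl; rewrite IH; reflexivity. Qed.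

Lemma disc_fun_real (x : nat -> C) (f : C -> C) (r : R) : Rabs r < 1 ->
  is_disc_fun x f ->
  is_pseries (fun n => Re (x n)) r (Re (f (RtoC r)))
  /\ is_pseries (fun n => Im (x n)) r (Im (f (RtoC r))).
Proof.
intros hr hx.
assert (h : Cmod (RtoC r) < 1) by (rewrite Cmod_R; exact hr).
generalize (hx _ h); unfold is_pseries; intros hs; split.
- apply is_series_Re in hs; revert hs; apply is_series_ext; intros n.
  rewrite pow_n_C, pow_n_pow, <- RtoC_pow.
  change (Re (RtoC (r ^ n) * x n) = r ^ n * Re (x n)).
  generalize (r ^ n); intros q; destruct (x n); unfold Re; simpl; ring.
- apply is_series_Im in hs; revert hs; apply is_series_ext; intros n.
  rewrite pow_n_C, pow_n_pow, <- RtoC_pow.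
  change (Im (RtoC (r ^ n) * x n) = r ^ n * Im (x n)).
  generalize (r ^ n); intros q; destruct (x n); unfold Im; simpl; ring.
Qed.

(** On the real diameter the Taylor series splits into two real power series, and the identity
    theorem for real power series applies to each. *)
Lemma disc_fun_unique (x y : nat -> C) (f : C -> C) :
  is_disc_fun x f -> is_disc_fun y f -> forall n, x n = y n.
Proof.
intros hx hy n; apply injective_projections.
- exact (real_pseries_unique (fun n => Re (x n)) (fun n => Re (y n))
    (fun r => Re (f (RtoC r))) (fun r hr => proj1 (disc_fun_real x f r hr hx))
    (fun r hr => proj1 (disc_fun_real y f r hr hy)) n).
- exact (real_pseries_unique (fun n => Im (x n)) (fun n => Im (y n))
    (fun r => Im (f (RtoC r))) (fun r hr => proj2 (disc_fun_real x f r hr hx))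
    (fun r hr => proj2 (disc_fun_real y f r hr hy)) n).
Qed.

Lemma disc_fun_monomial (c : C) (i : nat) (f : C -> C) :
  (forall z, Cmod z < 1 -> f z = (c * Cpow z i)%C) ->
  is_disc_fun (fun n => c * kron i n)%C f.
Proof.
intros hf z hz; rewrite hf by exact hz.
replace (c * Cpow z i)%C with
  (scal (K := C_Ring) (V := C_ModuleSpace) (pow_n (K := C_Ring) z i) (c * kron i i)%C).
- apply (is_series_single (V := C_NormedModule)
    (fun n => scal (K := C_Ring) (V := C_ModuleSpace) (pow_n (K := C_Ring) z n) (c * kron i n)%C)).
  intros n hn; rewrite kron_neq by exact hn.
  rewrite Cmult_0_r; apply (Cmult_0_r (pow_n (K := C_Ring) z n)).
- rewrite kron_same, pow_n_C.
  change (Cpow z i * (c * 1) = c * Cpow z i)%C; ring.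
Qed.

(** The branch of [phi'^{nu/2}] contributes the phase [s nu / 2] and the monomial contributes
    [s i]. *)
Lemma Dplus_rot {nu : R} {hnu : 0 < nu} (pi : Mob -> Hdisc nu hnu -> Hdisc nu hnu)
    (hpi : is_Dplus_rep pi) (s : R) (hs : - PI < s <= PI) (i : nat) :
  pi (mob_inv (mob_rot s hs)) (basis i)
  = scal (expi (s * (nu / 2 + INR i))) (basis i : Hdisc nu hnu).
Proof.
apply l2_ext; intros n.
set (v := expi _).
change ((pi (mob_inv (mob_rot s hs)) (basis i)) n = (v * kron i n)%C).
apply (disc_fun_unique _ (fun n => v * kron i n)%C
  (R_action nu (RtoC 0) (mob_rot s hs) (fun z => Cpow z i))).
- apply (proj2 hpi); intros z hz.
  generalize (disc_fun_monomial (RtoC 1) i (fun z => Cpow z i)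
    (fun z _ => eq_sym (Cmult_1_l _)) z hz).
  apply is_series_ext; intros k; rewrite Cmult_1_l; reflexivity.
- apply disc_fun_monomial; intros z hz.
  rewrite R_action_rot by lra.
  rewrite Cpow_mult_l, expi_pow, Cmult_assoc, <- expi_plus; unfold v.
  do 2 f_equal; ring.
Qed.

(** The conjugations in [D^-] reverse the sign of the weights, so they are bounded above instead of
    below. *)
Lemma Dminus_rot {nu : R} {hnu : 0 < nu} (pi : Mob -> Hdisc nu hnu -> Hdisc nu hnu)
    (hpi : is_Dminus_rep pi) (s : R) (hs : - PI < s <= PI) (i : nat) :
  pi (mob_inv (mob_rot s hs)) (basis i)
  = scal (expi (s * - (nu / 2 + INR i))) (basis i : Hdisc nu hnu).
Proof.
apply l2_ext; intros n.
set (v := expi _).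
change ((pi (mob_inv (mob_rot s hs)) (basis i)) n = (v * kron i n)%C).
apply (disc_fun_unique _ (fun n => v * kron i n)%C
  (fun z => Cconj (mob_deriv_pow (mob_rot s hs) nu (Cconj z))
            * Cpow (Cconj (mob_fun (mob_rot s hs) (Cconj z))) i)%C).
- apply (proj2 hpi _ _ (fun z => Cpow z i)); intros z hz.
  generalize (disc_fun_monomial (RtoC 1) i (fun z => Cpow z i)
    (fun z _ => eq_sym (Cmult_1_l _)) z hz).
  apply is_series_ext; intros k; rewrite Cmult_1_l; reflexivity.
- apply disc_fun_monomial; intros z hz.
  rewrite mob_deriv_pow_rot, mob_fun_rot, Cmult_conj, Cconj_conj, <- !expi_opp.
  rewrite Cpow_mult_l, expi_pow, Cmult_assoc, <- expi_plus; unfold v.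
  do 2 f_equal; ring.
Qed.

Section CircleRep.
Context {w : Z -> R} {hw : forall n, 0 < w n} {lambda : R} {mu : C}.
Variable pi : Mob -> Hcircle w hw -> Hcircle w hw.
Hypothesis hpi : is_R_rep lambda mu pi.

Lemma circle_rot (s : R) (hs : - PI < s <= PI) (n : Z) :
  pi (mob_inv (mob_rot s hs)) (basis n)
  = scal (expi (s * (lambda / 2 + IZR n))) (basis n : Hcircle w hw).
Proof.
apply l2_ext; intros p.
set (v := expi _).
change ((pi (mob_inv (mob_rot s hs)) (basis n)) p = (v * kron n p)%C).
apply (is_circle_fun_unique _ (fun p => v * kron n p)%C
  (R_action lambda mu (mob_rot s hs) (circle_pow n))).
- apply (proj2 hpi), circle_fun_pow.
- clear p; intros p.
  apply (is_RInt_ext (V := C_R_NormedModule)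
    (fun th => v * (expi (IZR n * th) * expi (- (IZR p * th))))%C).
  + intros th _; rewrite R_action_rot by (rewrite Cmod_expi; lra).
    rewrite <- (expi_plus s th), circle_pow_expi; unfold v.
    rewrite <- !expi_plus; f_equal; ring.
  + replace (RtoC (2 * PI) * (v * kron n p))%C
      with (v * (RtoC (2 * PI) * kron n p))%C by ring.
    apply is_RInt_Cmult, is_RInt_expi_shift.
Qed.

Lemma circle_real (t : R) (ht : -1 < t < 1) (n p : Z) :
  coef (pi (mob_inv (mob_real t ht)) (basis n)) p = entry lambda mu n p t.
Proof.
apply (is_circle_fun_unique _ (fun p => entry lambda mu n p t)
  (R_action lambda mu (mob_real t ht) (circle_pow n))).
- apply (proj2 hpi), circle_fun_pow.
- intros q; apply is_RInt_entry.
Qed.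
End CircleRep.

Lemma mob_inv_rot_theta (s : R) (hs : - PI < s <= PI) :
  expi (mob_theta (mob_inv (mob_rot s hs))) = expi (- s).
Proof. simpl mob_theta; rewrite expi_inv_theta, expi_opp; reflexivity. Qed.

Lemma mob_inv_rot_a (s : R) (hs : - PI < s <= PI) :
  mob_a (mob_inv (mob_rot s hs)) = RtoC 0.
Proof. simpl mob_a; ring. Qed.

Lemma mob_inv_real_theta (t : R) (ht : -1 < t < 1) :
  expi (mob_theta (mob_inv (mob_real t ht))) = RtoC 1.
Proof. simpl mob_theta; rewrite expi_inv_theta; simpl; rewrite expi_0; apply Cconj_R. Qed.

Lemma mob_inv_real_a (t : R) (ht : -1 < t < 1) :
  mob_a (mob_inv (mob_real t ht)) = RtoC (- t).
Proof. simpl mob_a; rewrite expi_0, RtoC_opp; ring. Qed.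

(** Take [s = 1 / d]: the two phases differ by [s * d = 1], and [e^i] is not 1 since [sin 1 > 0].
    Applied with [d] the deviation from a weight shift by one, it shows that the other matrix
    entries vanish. *)
Lemma separating_rotation (d : Z) : d <> 0%Z -> exists s (hs : - PI < s <= PI),
  forall x y, y = x + 1 + IZR d -> (expi (- s) * expi (s * y))%C <> expi (s * x).
Proof.
intros hd.
assert (hd' : IZR d <> 0) by (apply not_0_IZR, hd).
assert (hle : Rabs (/ IZR d) <= 1).
{ rewrite Rabs_inv, <- abs_IZR, <- Rinv_1.
  apply Rinv_le_contravar; [lra | apply IZR_le; lia]. }
generalize PI2_1; intros hpi.
assert (hs : - PI < / IZR d <= PI) by (apply Rabs_le_between in hle; lra).
exists (/ IZR d), hs; intros x y -> h.
rewrite <- expi_plus in h.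
replace (- / IZR d + / IZR d * (x + 1 + IZR d)) with (/ IZR d * x + 1) in h
  by (field; exact hd').
rewrite expi_plus in h.
assert (h1 : expi 1 = RtoC 1).
{ generalize (expi_neq0 (/ IZR d * x)); set (u := expi (/ IZR d * x)) in *; intros hu.
  transitivity (u * expi 1 / u)%C; [field; exact hu | rewrite h; field; exact hu]. }
rewrite expiE in h1; injection h1; intros h2 _.
generalize (sin_gt_0 1); lra.
Qed.

Lemma basis_of_coef {I : Type} {e : enumeration I} {w : I -> R} {hw : forall i, 0 < w i}
    (x : l2_Hilbert I e w hw) (q : I) :
  (forall p, p <> q -> coef x p = RtoC 0) -> x = scal (coef x q) (basis q).
Proof.
intros h; apply l2_ext; intros p.
change (coef x p = (coef x q * kron q p)%C).
destruct (excluded_middle_informative (p = q)) as [-> | hp].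
- rewrite kron_same; ring.
- rewrite kron_neq by exact hp; rewrite h by exact hp; ring.
Qed.

Section HomogeneousRelations.
Context {H : Hilbert} {pi : Mob -> H -> H} {T : H -> H}.
Hypotheses (hT : homogeneous T) (hpi : associated pi T).

Lemma rot_intertwining (s : R) (hs : - PI < s <= PI) (y : H) :
  pi (mob_inv (mob_rot s hs)) (scal (expi (- s)) (T y))
  = T (pi (mob_inv (mob_rot s hs)) y).
Proof.
generalize (mob_intertwining pi T hT hpi (mob_inv (mob_rot s hs)) y).
rewrite mob_inv_rot_theta, mob_inv_rot_a, Cconj_R.
assert (h : forall a b : H, minus a (scal (RtoC 0) b) = a).
{ intros a b; transitivity (minus a (zero : H));
    [f_equal; apply (scal_zero_l (V := H)) | exact (minus_zero_r (G := H) a)]. }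
rewrite !h; auto.
Qed.

(** The inverse of [phi_{0,t}] has parameter [-t], whence the plus signs. *)
Lemma real_intertwining (t : R) (ht : -1 < t < 1) (y : H) :
  pi (mob_inv (mob_real t ht)) (plus (T y) (scal (RtoC t) y))
  = T (pi (mob_inv (mob_real t ht)) (plus y (scal (RtoC t) (T y)))).
Proof.
generalize (mob_intertwining pi T hT hpi (mob_inv (mob_real t ht)) y).
rewrite mob_inv_real_theta, mob_inv_real_a, Cconj_R.
assert (h : forall a b : H, minus a (scal (RtoC (- t)) b) = plus a (scal (RtoC t) b)).
{ intros a b; unfold minus; f_equal.
  rewrite RtoC_opp; change (Copp t) with (opp (RtoC t : C_AbsRing)).
  transitivity (opp (opp (scal (RtoC t) b)));
    [f_equal; exact (scal_opp_l (V := H) (RtoC t : C_AbsRing) b) | apply opp_opp]. }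
rewrite !h; intros <-; f_equal; symmetry; apply (scal_one (V := H)).
Qed.
End HomogeneousRelations.

(** * Non-integrality of [mu] and [lambda + mu] *)

Lemma Cmult_integral (x y : C) : (x * y)%C = RtoC 0 -> y <> RtoC 0 -> x = RtoC 0.
Proof. intros h hy; transitivity (x * y / y)%C; [field; exact hy | rewrite h; field; exact hy]. Qed.

Lemma Cplus_Z_neq0 (z : C) (n : Z) : (forall j : Z, z <> RtoC (IZR j)) -> (z + IZR n)%C <> RtoC 0.
Proof.
intros h h0; apply (h (- n)%Z); rewrite opp_IZR, RtoC_opp.
transitivity (z + IZR n - IZR n)%C; [ring | rewrite h0; ring].
Qed.

(** In the principal series the real part of [mu] lies in [[0, 1)]; the only integer there, 0,
    forces [lambda = 1] and [s = 0], that is [P_{1,0}]. In the complementary series [mu] lies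
    strictly between 0 and 1. *)
Lemma series_mu_not_int {lambda : R} (c : continuous_series lambda) : ~ is_P10 c ->
  forall j : Z, series_mu c <> RtoC (IZR j).
Proof.
intros hc j h.
destruct c as [s hl hs | sigma hl hs]; simpl in h; generalize (f_equal fst h) (f_equal snd h).
- destruct s as [s1 s2]; simpl in hs; subst s1; simpl; intros h1 h2.
  assert (hj : -1 < IZR j < 1) by lra.
  assert (j = 0%Z).
  { destruct hj as [a b]; apply lt_IZR in a; apply lt_IZR in b; lia. }
  subst j; apply hc; split; [lra | apply injective_projections; simpl; lra].
- simpl; intros h1 _.
  generalize (Rle_abs lambda) (Rle_abs (- lambda)); rewrite Rabs_Ropp; intros k1 k2.
  assert (hj : 0 < IZR j < 1) by lra.
  destruct hj as [a b]; apply lt_IZR in a; apply lt_IZR in b; lia.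
Qed.

(** Now the real part is [(1 + lambda) / 2] in the principal series, in [(0, 1]], and the integer 1
    again leads to [P_{1,0}]. The complementary series stays strictly between 0 and 1. *)
Lemma lambda_series_mu_not_int {lambda : R} (c : continuous_series lambda) : ~ is_P10 c ->
  forall j : Z, (lambda + series_mu c)%C <> RtoC (IZR j).
Proof.
intros hc j h.
destruct c as [s hl hs | sigma hl hs]; simpl in h; generalize (f_equal fst h) (f_equal snd h).
- destruct s as [s1 s2]; simpl in hs; subst s1; simpl; intros h1 h2.
  assert (hj : 0 < IZR j < 2) by lra.
  assert (j = 1%Z).
  { destruct hj as [a b]; apply lt_IZR in a; apply lt_IZR in b; lia. }
  subst j; apply hc; split; [lra | apply injective_projections; simpl; lra].
- simpl; intros h1 _.
  generalize (Rle_abs lambda) (Rle_abs (- lambda)); rewrite Rabs_Ropp; intros k1 k2.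
  assert (hj : 0 < IZR j < 1) by lra.
  destruct hj as [a b]; apply lt_IZR in a; apply lt_IZR in b; lia.
Qed.

Lemma inner_zero_l {H : Hilbert} (y : H) : inner zero y = RtoC 0.
Proof.
transitivity (inner (scal (RtoC 0) (zero : H)) y).
- f_equal; symmetry; apply (scal_zero_l (V := H)).
- rewrite inner_scal_l; ring.
Qed.

(** * The block operator *)

Section Block.
Context {lambda : R} {m k : Z} {hm : 0 < lambda + 2 * IZR m}
  {hk : 0 < 2 - lambda + 2 * IZR k} {w : Z -> R} {hw : forall n, 0 < w n} {mu : C}.
Notation H1 := (Hcircle w hw).
Notation Hp := (Hdisc (lambda + 2 * IZR m) hm).
Notation Hm := (Hdisc (2 - lambda + 2 * IZR k) hk).
Notation H2 := (hsum Hp Hm).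
Context {pi1 : Mob -> H1 -> H1} {pip : Mob -> Hp -> Hp} {pim : Mob -> Hm -> Hm}
  {T1 : H1 -> H1} {S1 : H2 -> H1} {S2 : H1 -> H2} {T2 : H2 -> H2}.
Hypotheses (hpi1 : is_R_rep lambda mu pi1) (hpip : is_Dplus_rep pip)
  (hpim : is_Dminus_rep pim)
  (hT1 : is_linear T1) (hS1 : is_linear S1) (hS2 : is_linear S2) (hT2 : is_linear T2)
  (hT : homogeneous (H := hsum H1 H2) (block_op T1 S1 S2 T2))
  (hassoc : associated (H := hsum H1 H2) (rep_sum pi1 (rep_sum pip pim))
              (block_op T1 S1 S2 T2)).
Hypotheses (hmu : forall j : Z, mu <> RtoC (IZR j))
  (hlmu : forall j : Z, (lambda + mu)%C <> RtoC (IZR j)).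

Notation V2 := (rep_sum pip pim).
Notation ep i := ((basis i, zero) : H2).
Notation em i := ((zero, basis i) : H2).

(** Rotation weights with [lambda / 2] subtracted, so that they share the scale on which [z^n] in
    [H1] has weight [n]. *)
Definition wt_plus (i : nat) : Z := (m + Z.of_nat i)%Z.
Definition wt_minus (i : nat) : Z := (- k - 1 - Z.of_nat i)%Z.

(** The two positivity hypotheses add up to [0 < m + k + 1]. *)
Lemma wt_minus_lt_plus (i j : nat) : (wt_minus i < wt_plus j)%Z.
Proof.
assert (h : IZR 0 < IZR (m + k + 1)) by (rewrite !plus_IZR; lra).
apply lt_IZR in h; unfold wt_minus, wt_plus; lia.
Qed.

Lemma pi1_zero phi : pi1 phi zero = zero.
Proof. exact (linear_zero _ (proj1 hpi1 phi)). Qed.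

Lemma pip_zero phi : pip phi zero = zero.
Proof. exact (linear_zero _ (proj1 hpip phi)). Qed.

Lemma pim_zero phi : pim phi zero = zero.
Proof. exact (linear_zero _ (proj1 hpim phi)). Qed.

(** Unitarity is given for the direct sum; testing it on vectors from one summand makes that summand
    isometric. *)
Lemma rep_inner phi (x y : hsum H1 H2) :
  (inner (pi1 phi (fst x)) (pi1 phi (fst y))
   + (inner (pip phi (fst (snd x))) (pip phi (fst (snd y)))
      + inner (pim phi (snd (snd x))) (pim phi (snd (snd y)))))%C
  = (inner (fst x) (fst y)
     + (inner (fst (snd x)) (fst (snd y)) + inner (snd (snd x)) (snd (snd y))))%C.
Proof. exact (unitary_inner _ (rep_unitary _ (proj1 hassoc) phi) x y). Qed.

Lemma pi1_inner phi x y : inner (pi1 phi x) (pi1 phi y) = inner x y.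
Proof.
generalize (rep_inner phi (x, (zero, zero)) (y, (zero, zero))); cbn [fst snd].
rewrite pip_zero, pim_zero, !inner_zero_l; intros h.
transitivity (inner (pi1 phi x) (pi1 phi y) + (RtoC 0 + RtoC 0))%C; [ring | rewrite h; ring].
Qed.

Lemma pim_inner phi x y : inner (pim phi x) (pim phi y) = inner x y.
Proof.
generalize (rep_inner phi (zero, (zero, x)) (zero, (zero, y))); cbn [fst snd].
rewrite pi1_zero, pip_zero, !inner_zero_l; intros h.
transitivity (RtoC 0 + (RtoC 0 + inner (pim phi x) (pim phi y)))%C; [ring | rewrite h; ring].
Qed.

Lemma pip_rot s hs i : pip (mob_inv (mob_rot s hs)) (basis i)
  = scal (expi (s * (lambda / 2 + IZR (wt_plus i)))) (basis i : Hp).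
Proof.
rewrite (Dplus_rot pip hpip); do 3 f_equal.
unfold wt_plus; rewrite plus_IZR, <- INR_IZR_INZ; field.
Qed.

Lemma pim_rot s hs i : pim (mob_inv (mob_rot s hs)) (basis i)
  = scal (expi (s * (lambda / 2 + IZR (wt_minus i)))) (basis i : Hm).
Proof.
rewrite (Dminus_rot pim hpim); do 3 f_equal.
unfold wt_minus; rewrite !minus_IZR, opp_IZR, <- INR_IZR_INZ; field.
Qed.

Lemma V2_pair phi (x : Hp) (y : Hm) : V2 phi ((x, y) : H2) = ((pip phi x, pim phi y) : H2).
Proof. reflexivity. Qed.

Lemma V2_zero phi : V2 phi (zero : H2) = zero.
Proof.
transitivity ((pip phi zero, pim phi zero) : H2); [reflexivity |].
rewrite pip_zero, pim_zero; reflexivity.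
Qed.

Lemma S1_zero : S1 zero = zero.
Proof. exact (linear_zero _ hS1). Qed.

Lemma T1_zero : T1 zero = zero.
Proof. exact (linear_zero _ hT1). Qed.

Lemma S2_zero : S2 zero = zero.
Proof. exact (linear_zero _ hS2). Qed.

(** * Weights of the blocks *)

Lemma rot_fst s (hs : - PI < s <= PI) (y1 : H1) (y2 : H2) :
  let phi := mob_inv (mob_rot s hs) in
  pi1 phi (scal (expi (- s)) (plus (T1 y1) (S1 y2)))
  = plus (T1 (pi1 phi y1)) (S1 (V2 phi y2)).
Proof.
exact (f_equal fst (rot_intertwining hT hassoc s hs ((y1, y2) : hsum H1 H2))).
Qed.

Lemma rot_snd s (hs : - PI < s <= PI) (y1 : H1) (y2 : H2) :
  let phi := mob_inv (mob_rot s hs) in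
  V2 phi (scal (expi (- s)) (plus (S2 y1) (T2 y2)))
  = plus (S2 (pi1 phi y1)) (T2 (V2 phi y2)).
Proof.
exact (f_equal snd (rot_intertwining hT hassoc s hs ((y1, y2) : hsum H1 H2))).
Qed.

Lemma real_fst t (ht : -1 < t < 1) (y1 : H1) (y2 : H2) :
  let phi := mob_inv (mob_real t ht) in
  pi1 phi (plus (plus (T1 y1) (S1 y2)) (scal (RtoC t) y1))
  = plus (T1 (pi1 phi (plus y1 (scal (RtoC t) (plus (T1 y1) (S1 y2))))))
         (S1 (V2 phi (plus y2 (scal (RtoC t) (plus (S2 y1) (T2 y2)))))).
Proof.
exact (f_equal fst (real_intertwining hT hassoc t ht ((y1, y2) : hsum H1 H2))).
Qed.

Lemma T1_weight j p : p <> (j + 1)%Z -> coef (T1 (basis j)) p = RtoC 0.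
Proof.
intros hp; destruct (separating_rotation (p - j - 1)) as [s [hs hne]]; [lia |].
set (phi := mob_inv (mob_rot s hs)).
apply (coef_zero_of_weights T1 (pi1 phi) (pi1 phi) j p (expi (- s))
  (expi (s * (lambda / 2 + IZR j))) (expi (s * (lambda / 2 + IZR p)))).
- exact hT1.
- apply pi1_inner.
- apply (circle_rot pi1 hpi1).
- apply (circle_rot pi1 hpi1).
- apply Cmod_expi.
- generalize (rot_fst s hs (basis j) zero); cbv zeta; fold phi.
  rewrite V2_zero, S1_zero, !plus_zero_r; auto.
- apply hne; rewrite !minus_IZR; ring.
Qed.

Lemma is_linear_inl : is_linear (U := Hp) (V := H2) (fun x => ((x, zero) : H2)).
Proof. exact (is_linear_prod (T := Hp) (U := Hp) (V := Hm) _ _ is_linear_id is_linear_zero). Qed.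

Lemma is_linear_inr : is_linear (U := Hm) (V := H2) (fun x => ((zero, x) : H2)).
Proof. exact (is_linear_prod (T := Hm) (U := Hp) (V := Hm) _ _ is_linear_zero is_linear_id). Qed.

Definition S1p (x : Hp) : H1 := S1 ((x, zero) : H2).
Definition S1m (x : Hm) : H1 := S1 ((zero, x) : H2).

Lemma is_linear_S1p : is_linear S1p.
Proof. exact (is_linear_comp (U := Hp) (V := H2) (W := H1) _ _ is_linear_inl hS1). Qed.

Lemma is_linear_S1m : is_linear S1m.
Proof. exact (is_linear_comp (U := Hm) (V := H2) (W := H1) _ _ is_linear_inr hS1). Qed.

Lemma S1_split (x : H2) : S1 x = plus (S1p (fst x)) (S1m (snd x)).
Proof.
destruct x as [x y]; unfold S1p, S1m.
rewrite <- (linear_plus _ hS1); f_equal.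
transitivity ((plus x zero, plus zero y) : H2); [| reflexivity].
rewrite plus_zero_r, plus_zero_l; reflexivity.
Qed.

Lemma S1p_weight i p : p <> (wt_plus i + 1)%Z -> coef (S1p (basis i)) p = RtoC 0.
Proof.
intros hp; destruct (separating_rotation (p - wt_plus i - 1)) as [s [hs hne]]; [lia |].
set (phi := mob_inv (mob_rot s hs)).
apply (coef_zero_of_weights S1p (pip phi) (pi1 phi) i p (expi (- s))
  (expi (s * (lambda / 2 + IZR (wt_plus i)))) (expi (s * (lambda / 2 + IZR p)))).
- apply is_linear_S1p.
- apply pi1_inner.
- apply pip_rot.
- apply (circle_rot pi1 hpi1).
- apply Cmod_expi.
- generalize (rot_fst s hs zero (ep i)); cbv zeta; fold phi.
  rewrite V2_pair, pi1_zero, T1_zero, !plus_zero_l, pim_zero; auto.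
- apply hne; rewrite !minus_IZR; ring.
Qed.

Lemma S1m_weight i p : p <> (wt_minus i + 1)%Z -> coef (S1m (basis i)) p = RtoC 0.
Proof.
intros hp; destruct (separating_rotation (p - wt_minus i - 1)) as [s [hs hne]]; [lia |].
set (phi := mob_inv (mob_rot s hs)).
apply (coef_zero_of_weights S1m (pim phi) (pi1 phi) i p (expi (- s))
  (expi (s * (lambda / 2 + IZR (wt_minus i)))) (expi (s * (lambda / 2 + IZR p)))).
- apply is_linear_S1m.
- apply pi1_inner.
- apply pim_rot.
- apply (circle_rot pi1 hpi1).
- apply Cmod_expi.
- generalize (rot_fst s hs zero (em i)); cbv zeta; fold phi.
  rewrite V2_pair, pi1_zero, T1_zero, !plus_zero_l, pip_zero; auto.
- apply hne; rewrite !minus_IZR; ring.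
Qed.

(** [T2] raises weights by one, and every weight of the antiholomorphic summand is below those of
    the holomorphic one. Hence [T2] cannot lead from the latter to the former. *)
Lemma T2_ep_snd i : snd (T2 (ep i)) = zero.
Proof.
set (B := fun x : Hp => snd (T2 ((x, zero) : H2)) : Hm).
assert (hB : is_linear (U := Hp) (V := Hm) B).
{ apply (is_linear_comp (U := Hp) (V := H2) (W := Hm) (fun x => T2 ((x, zero) : H2)));
    [| apply (is_linear_snd (U := Hp) (V := Hm))].
  exact (is_linear_comp (U := Hp) (V := H2) (W := H2) _ _ is_linear_inl hT2). }
change (B (basis i) = zero); apply l2_ext; intros q.
generalize (wt_minus_lt_plus q i); intros hlt.
destruct (separating_rotation (wt_minus q - wt_plus i - 1)) as [s [hs hne]]; [lia |].
set (phi := mob_inv (mob_rot s hs)).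
apply (coef_zero_of_weights B (pip phi) (pim phi) i q (expi (- s))
  (expi (s * (lambda / 2 + IZR (wt_plus i)))) (expi (s * (lambda / 2 + IZR (wt_minus q))))).
- exact hB.
- apply pim_inner.
- apply pip_rot.
- apply pim_rot.
- apply Cmod_expi.
- generalize (rot_snd s hs zero (ep i)); cbv zeta; fold phi.
  rewrite V2_pair, pi1_zero, S2_zero, !plus_zero_l, pim_zero.
  intros h; exact (f_equal snd h).
- apply hne; rewrite !minus_IZR; ring.
Qed.

(** The weight [a_j] of the shift [T1]. *)
Definition T1_coef (j : Z) : C := coef (T1 (basis j)) (j + 1)%Z.

Lemma coef_T1 x p : coef (T1 x) p = (T1_coef (p - 1) * coef x (p - 1)%Z)%C.
Proof.
unfold T1_coef; replace (p - 1 + 1)%Z with p by ring.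
apply (linear_coef_single T1); [exact hT1 |].
intros i hi; apply T1_weight; lia.
Qed.

Lemma T1_basis j : T1 (basis j) = scal (T1_coef j) (basis (j + 1)%Z : H1).
Proof. apply basis_of_coef; intros p hp; apply T1_weight, hp. Qed.

Lemma coef_S1p_zero p : (forall i, wt_plus i = (p - 1)%Z -> S1p (basis i) = zero) ->
  forall x, coef (S1p x) p = RtoC 0.
Proof.
intros h; apply linear_coef_zero; [apply is_linear_S1p |]; intros i.
destruct (Z.eq_dec (wt_plus i) (p - 1)) as [e | e].
- rewrite h by exact e; reflexivity.
- apply S1p_weight; lia.
Qed.

Lemma coef_S1m_zero p : (forall i, wt_minus i = (p - 1)%Z -> S1m (basis i) = zero) ->
  forall x, coef (S1m x) p = RtoC 0.
Proof.
intros h; apply linear_coef_zero; [apply is_linear_S1m |]; intros i.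
destruct (Z.eq_dec (wt_minus i) (p - 1)) as [e | e].
- rewrite h by exact e; reflexivity.
- apply S1m_weight; lia.
Qed.

(** * First-order relations *)

Notation dentry n p := (kron (n + 1)%Z p * (lambda + mu + IZR n)
  + kron (n - 1)%Z p * (mu - IZR n))%C.

Lemma coef_of_eq_plus (x y z : H1) p : x = plus y z -> coef x p = (coef y p + coef z p)%C.
Proof. intros ->; reflexivity. Qed.

(** Apply the intertwining relation to the vector [(0, y)] and differentiate coordinate [p] at
    [t = 0]. The second hypothesis removes the term that returns through [S1], and of the term
    carrying a factor [t] only the value at 0 remains. *)
Lemma H2_relation (y : H2) (b : C) (q p : Z) :
  S1 y = scal b (basis q : H1) ->
  (forall phi t, coef (S1 (V2 phi (plus y (scal (RtoC t) (T2 y))))) p = RtoC 0) ->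
  (b * dentry q p = T1_coef (p - 1) * (b * kron q (p - 1)%Z))%C.
Proof.
intros hb hz.
apply (tangent_unique (fun t => b * entry lambda mu q p t)%C
  (fun t => T1_coef (p - 1) * (b * (RtoC t * entry lambda mu q (p - 1) t)))%C
  (b * kron q p)%C (T1_coef (p - 1) * (b * 0))%C).
- apply tangent_scal, tangent_entry.
- do 2 apply tangent_scal; eapply tangent_id_mult, tangent_entry.
- intros t ht; generalize (real_fst t ht zero y); cbv zeta.
  set (phi := mob_inv (mob_real t ht)).
  rewrite T1_zero, S2_zero, hb, !plus_zero_l.
  intros h; apply (coef_of_eq_plus _ _ _ p) in h; rewrite coef_T1, hz in h.
  rewrite <- !(circle_real pi1 hpi1 t ht); fold phi.
  assert (e1 : pi1 phi (plus (scal b (basis q : H1)) (scal (RtoC t) (zero : H1)))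
    = scal b (pi1 phi (basis q))).
  { rewrite <- (linear_scal _ (proj1 hpi1 phi)); f_equal.
    transitivity (plus (scal b (basis q : H1)) (zero : H1));
      [f_equal; apply (scal_zero_r (V := H1)) | apply plus_zero_r]. }
  assert (e2 : pi1 phi (scal (RtoC t) (scal b (basis q : H1)))
    = scal (RtoC t) (scal b (pi1 phi (basis q)))).
  { rewrite !(linear_scal _ (proj1 hpi1 phi)); reflexivity. }
  assert (e1' := f_equal (fun x : H1 => coef x p) e1).
  assert (e2' := f_equal (fun x : H1 => coef x (p - 1)%Z) e2).
  transitivity (coef (pi1 phi (plus (scal b (basis q : H1)) (scal (RtoC t) (zero : H1)))) p);
    [symmetry; exact e1' |].
  transitivity (T1_coef (p - 1) * coef (pi1 phi (scal (RtoC t) (scal b (basis q : H1)))) (p - 1)%Z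
    + 0)%C; [exact h |].
  rewrite Cplus_0_r; f_equal; etransitivity; [exact e2' |].
  change (t * (b * coef (pi1 phi (basis q)) (p - 1)%Z)
    = b * (t * coef (pi1 phi (basis q)) (p - 1)%Z))%C; ring.
Qed.

(** The same differentiation for the vector [(z^j, 0)]; the hypothesis removes the contribution that
    passes through [S2] and back through [S1]. *)
Lemma H1_relation (j p : Z) :
  (forall y : H2, coef (S1 y) p = RtoC 0) ->
  (T1_coef j * dentry (j + 1)%Z p + kron j p
   = T1_coef (p - 1) * (dentry j (p - 1)%Z + T1_coef j * kron (j + 1)%Z (p - 1)%Z))%C.
Proof.
intros hz.
apply (tangent_unique
  (fun t => T1_coef j * entry lambda mu (j + 1) p t + RtoC t * entry lambda mu j p t)%C
  (fun t => T1_coef (p - 1) * (entry lambda mu j (p - 1) t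
     + T1_coef j * (RtoC t * entry lambda mu (j + 1) (p - 1) t)))%C
  (T1_coef j * kron (j + 1)%Z p + 0)%C
  (T1_coef (p - 1) * (kron j (p - 1)%Z + T1_coef j * 0))%C).
- apply tangent_plus; [apply tangent_scal, tangent_entry |].
  eapply tangent_id_mult, tangent_entry.
- apply tangent_scal, tangent_plus; [apply tangent_entry |].
  apply tangent_scal; eapply tangent_id_mult, tangent_entry.
- intros t ht; generalize (real_fst t ht (basis j) zero); cbv zeta.
  set (phi := mob_inv (mob_real t ht)).
  rewrite S1_zero, !plus_zero_r, T1_basis.
  intros h; apply (coef_of_eq_plus _ _ _ p) in h; rewrite coef_T1, hz in h.
  rewrite <- !(circle_real pi1 hpi1 t ht); fold phi.
  assert (e : forall a b (x y : H1) i, coef (pi1 phi (plus (scal a x) (scal b y))) i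
    = (a * coef (pi1 phi x) i + b * coef (pi1 phi y) i)%C).
  { intros a b x y i.
    rewrite (linear_plus _ (proj1 hpi1 phi)), !(linear_scal _ (proj1 hpi1 phi)).
    reflexivity. }
  etransitivity; [symmetry; apply e |].
  etransitivity; [exact h |].
  rewrite Cplus_0_r; f_equal.
  set (u := coef (pi1 phi (basis j)) (p - 1)%Z).
  set (v := coef (pi1 phi (basis (j + 1)%Z)) (p - 1)%Z).
  transitivity (RtoC 1 * u + (t * T1_coef j) * v)%C; [| ring].
  etransitivity; [| apply (e (RtoC 1) (t * T1_coef j)%C (basis j) (basis (j + 1)%Z))].
  do 3 f_equal; [symmetry; apply (scal_one (V := H1)) | apply (scal_assoc (V := H1))].
Qed.

(** * Vanishing of [S1] *)

Lemma coef_S1_zero (p : Z) (x : H2) :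
  (forall y, coef (S1p y) p = RtoC 0) -> coef (S1m (snd x)) p = RtoC 0 ->
  coef (S1 x) p = RtoC 0.
Proof.
intros h1 h2; rewrite (coef_of_eq_plus _ _ _ p (S1_split x)), h1, h2; ring.
Qed.

Lemma S1p_basis_eq i : S1p (basis i) = scal (coef (S1p (basis i)) (wt_plus i + 1)%Z)
  (basis (wt_plus i + 1)%Z : H1).
Proof. apply basis_of_coef; intros p; apply S1p_weight. Qed.

Lemma S1m_basis_eq i : S1m (basis i) = scal (coef (S1m (basis i)) (wt_minus i + 1)%Z)
  (basis (wt_minus i + 1)%Z : H1).
Proof. apply basis_of_coef; intros p; apply S1m_weight. Qed.

(** In coordinate [j], one below the weight of [S1p (basis i)], the relation reads
    [b (mu - (j + 1)) = 0]. Of the holomorphic summand this coordinate sees only the vector of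
    weight [j - 1], killed by the induction hypothesis, or absent when [i = 0]. *)
Lemma S1p_basis i : S1p (basis i) = zero.
Proof.
induction i as [i IH] using lt_wf_ind.
generalize (S1p_basis_eq i).
set (j := wt_plus i); set (b := coef (S1p (basis i)) (j + 1)%Z); intros hb.
assert (h := H2_relation (ep i) b (j + 1)%Z j hb).
assert (hb0 : b = RtoC 0).
{ apply (Cmult_integral b (mu - IZR (j + 1))%C).
  - rewrite (kron_neq (j + 1 + 1)%Z j), (kron_neq (j + 1)%Z (j - 1)%Z) in h by lia.
    replace (j + 1 - 1)%Z with j in h by ring; rewrite kron_same in h.
    transitivity (b * (0 * (lambda + mu + IZR (j + 1)) + 1 * (mu - IZR (j + 1))))%C; [ring |].
    rewrite h; [ring |]; intros phi t; apply coef_S1_zero.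
    + apply coef_S1p_zero; intros i' hi'; apply IH.
      unfold j, wt_plus in hi'; lia.
    (* [T2] and the representation both preserve the holomorphic summand, so [S1m] is fed with
       zero. *)
    + assert (e : snd (V2 phi (plus (ep i) (scal (RtoC t) (T2 (ep i))))) = zero).
      { change (pim phi (plus zero (scal (RtoC t) (snd (T2 (ep i))))) = zero).
        rewrite T2_ep_snd, plus_zero_l.
        transitivity (pim phi (zero : Hm)); [f_equal; apply (scal_zero_r (V := Hm)) |].
        apply pim_zero. }
      etransitivity; [exact (f_equal (fun y : Hm => coef (S1m y) j) e) |].
      exact (f_equal (fun y : H1 => coef y j) (linear_zero _ is_linear_S1m)).
  - intros h0; apply (hmu (j + 1)%Z).
    transitivity (mu - IZR (j + 1) + IZR (j + 1))%C; [ring | rewrite h0; ring]. }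
rewrite hb, hb0; apply (scal_zero_l (V := H1)).
Qed.

Lemma coef_S1p p x : coef (S1p x) p = RtoC 0.
Proof. apply coef_S1p_zero; intros i _; apply S1p_basis. Qed.

(** Coordinate [j + 2] of [H1_relation], which [S1] reaches only from weight [j + 1]. *)
Lemma raising_relation j :
  (forall i, wt_minus i = (j + 1)%Z -> S1m (basis i) = zero) ->
  (T1_coef j * (lambda + mu + IZR j + 1) = T1_coef (j + 1) * (lambda + mu + IZR j + T1_coef j))%C.
Proof.
intros hz.
assert (h := H1_relation j (j + 1 + 1)%Z).
replace (j + 1 + 1 - 1)%Z with (j + 1)%Z in h by ring.
rewrite !kron_same in h.
rewrite (kron_neq (j + 1 - 1)%Z), (kron_neq j), (kron_neq (j - 1)%Z) in h by lia.
transitivity (T1_coef j * (1 * (lambda + mu + IZR (j + 1)) + 0 * (mu - IZR (j + 1))) + 0)%C.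
- rewrite plus_IZR, RtoC_plus; ring.
- rewrite h; [ring |]; intros y; apply coef_S1_zero; [apply coef_S1p |].
  apply coef_S1m_zero; intros i hi; apply hz; lia.
Qed.

(** Coordinate [j] of [H1_relation], which [S1] reaches only from weight [j - 1]. *)
Lemma lowering_relation j :
  (forall i, wt_minus i = (j - 1)%Z -> S1m (basis i) = zero) ->
  (T1_coef j * (mu - IZR j - 1) + 1 = T1_coef (j - 1) * (mu - IZR j))%C.
Proof.
intros hz; assert (h := H1_relation j j).
replace (j + 1 - 1)%Z with j in h by ring.
rewrite !kron_same in h.
rewrite (kron_neq (j + 1 + 1)%Z), !(kron_neq (j + 1)%Z) in h by lia.
transitivity (T1_coef j * (0 * (lambda + mu + IZR (j + 1)) + 1 * (mu - IZR (j + 1))) + 1)%C.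
- rewrite plus_IZR, RtoC_plus; ring.
- rewrite h; [ring |]; intros y; apply coef_S1_zero; [apply coef_S1p |].
  apply coef_S1m_zero; intros i hi; apply hz; lia.
Qed.

(* The two alternatives are the two homogeneous weighted shifts associated with
   [R_{lambda,mu}], the first being multiplication by [z]. *)
Definition T1_coef_spec (j : Z) : Prop :=
  T1_coef j = RtoC 1 \/ (T1_coef j * (IZR j + 1 - mu) = lambda + mu + IZR j)%C.

(** The antiholomorphic weights stay below [m], so raising at [m + 1] and lowering at [m + 2] are
    both available. *)
Lemma T1_coef_spec_start : T1_coef_spec (m + 1).
Proof.
set (j := (m + 1)%Z).
assert (hz : forall l i, (m <= l)%Z -> wt_minus i = l -> S1m (basis i) = zero).
{ intros l i hl hi; generalize (wt_minus_lt_plus i 0); unfold wt_plus; lia. }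
assert (e1 := raising_relation j (fun i => hz (j + 1)%Z i ltac:(unfold j; lia))).
assert (e2 := lowering_relation (j + 1) (fun i => hz (j + 1 - 1)%Z i ltac:(unfold j; lia))).
replace (j + 1 - 1)%Z with j in e2 by ring.
rewrite plus_IZR, RtoC_plus in e2.
unfold T1_coef_spec; set (A := T1_coef j) in *; set (B := T1_coef (j + 1)) in *.
set (L := (lambda + mu + IZR j)%C) in *.
(* Eliminating [B] between the two relations leaves a quadratic equation in [A], whose factors are
   the two alternatives. *)
assert (q : ((A - 1) * ((mu - IZR j - 1) * A + L))%C = RtoC 0).
{ transitivity ((A * (mu - IZR j - 1) - 1) * (L + A)
    - (A * (L + 1)) * (mu - IZR j - 2))%C; [ring |].
  rewrite e1.
  transitivity ((L + A) * (A * (mu - (IZR j + 1)) - (B * (mu - (IZR j + 1) - 1) + 1)))%C;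
    [ring | rewrite e2; ring]. }
destruct (Ceq_dec ((mu - IZR j - 1) * A + L)%C (RtoC 0)) as [h | h].
- right; transitivity (L - ((mu - IZR j - 1) * A + L))%C; [ring | rewrite h; ring].
- left; apply Cmult_integral in q; [| exact h].
  transitivity (A - 1 + 1)%C; [ring | rewrite q; ring].
Qed.

(** Equality would give [lambda + mu = 1 - j] in the first alternative and, after cancelling the
    nonzero [lambda + mu + j], [mu = j] in the second. *)
Lemma T1_coef_spec_neq j : T1_coef_spec j -> (lambda + mu + IZR j - T1_coef j)%C <> RtoC 0.
Proof.
intros h h0.
assert (e : T1_coef j = (lambda + mu + IZR j)%C).
{ transitivity (lambda + mu + IZR j - (lambda + mu + IZR j - T1_coef j))%C;
    [ring | rewrite h0; ring]. }
assert (hL := Cplus_Z_neq0 _ j hlmu).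
destruct h as [h | h].
- apply (hlmu (1 - j)%Z); rewrite minus_IZR, RtoC_minus.
  transitivity (lambda + mu + IZR j - IZR j)%C; [ring | rewrite <- e, h; reflexivity].
- rewrite e in h; apply (hmu j).
  assert (h2 : (IZR j - mu)%C = RtoC 0).
  { apply (Cmult_integral _ (lambda + mu + IZR j)%C); [| exact hL].
    transitivity ((lambda + mu + IZR j) * (IZR j + 1 - mu) - (lambda + mu + IZR j))%C;
      [ring | rewrite h; ring]. }
  transitivity (IZR j - (IZR j - mu))%C; [ring | rewrite h2; ring].
Qed.

(** For either value of [B] the raising relation becomes linear in [A]; dividing by [L],
    respectively [L + 1], gives the same alternative one step lower. Both divisors are nonzero
    because [lambda + mu] is not an integer. *)
Lemma T1_coef_spec_pred j : T1_coef_spec (j + 1) ->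
  (T1_coef j * (lambda + mu + IZR j + 1) = T1_coef (j + 1) * (lambda + mu + IZR j + T1_coef j))%C ->
  T1_coef_spec j.
Proof.
intros h e; generalize (Cplus_Z_neq0 _ j hlmu); intros hL.
generalize (Cplus_Z_neq0 _ (j + 1) hlmu); intros hL1.
unfold T1_coef_spec in *; set (A := T1_coef j) in *; set (B := T1_coef (j + 1)) in *.
rewrite plus_IZR, RtoC_plus in h, hL1; set (L := (lambda + mu + IZR j)%C) in *.
destruct h as [h | h].
- left; rewrite h in e.
  assert (h2 : (A - 1)%C = RtoC 0).
  { apply (Cmult_integral _ L); [| exact hL].
    transitivity (A * (L + 1) - (L + A))%C; [ring | rewrite e; ring]. }
  transitivity (A - 1 + 1)%C; [ring | rewrite h2; ring].
- right.
  assert (h2 : (A * (IZR j + 1 - mu) - L)%C = RtoC 0).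
  { apply (Cmult_integral _ (lambda + mu + (IZR j + 1))%C); [| exact hL1].
    transitivity (A * (L + 1) * (IZR j + 1 + 1 - mu) - (L + A) * (lambda + mu + (IZR j + 1)))%C;
      [unfold L; ring |].
    rewrite e, <- h; ring. }
  transitivity (A * (IZR j + 1 - mu) - L + L)%C; [ring | rewrite h2; ring].
Qed.

(** The two claims descend together: vanishing at weight [j + 1] provides the raising relation at
    [j], and the dichotomy at [j + 1] provides vanishing at weight [j]. *)
Lemma S1m_descent (d : nat) :
  T1_coef_spec (m + 1 - Z.of_nat d)
  /\ forall i, (m + 1 - Z.of_nat d <= wt_minus i)%Z -> S1m (basis i) = zero.
Proof.
induction d as [| d [IH1 IH2]].
- split; [replace (m + 1 - Z.of_nat 0)%Z with (m + 1)%Z by (simpl; ring);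
    apply T1_coef_spec_start |].
  intros i hi; generalize (wt_minus_lt_plus i 0); unfold wt_plus; lia.
- set (j := (m + 1 - Z.of_nat (S d))%Z).
  replace (m + 1 - Z.of_nat d)%Z with (j + 1)%Z in IH1, IH2 by (unfold j; lia).
  split.
  { apply T1_coef_spec_pred; [exact IH1 |]; apply raising_relation.
    intros i hi; apply IH2; lia. }
  intros i hi; destruct (Z.eq_dec (wt_minus i) j) as [e | e]; [| apply IH2; lia].
  generalize (S1m_basis_eq i); rewrite e.
  set (b := coef (S1m (basis i)) (j + 1)%Z); intros hb.
  (* Coordinate [j + 2] gives [b (lambda + mu + j + 1) = a_(j+1) b]; [S1] reaches it only from
     weight [j + 1], already treated. *)
  assert (h := H2_relation (em i) b (j + 1)%Z (j + 1 + 1)%Z hb).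
  assert (hb0 : b = RtoC 0); [| rewrite hb, hb0; apply (scal_zero_l (V := H1))].
  apply (Cmult_integral b (lambda + mu + IZR (j + 1) - T1_coef (j + 1))%C);
    [| apply T1_coef_spec_neq, IH1].
  replace (j + 1 + 1 - 1)%Z with (j + 1)%Z in h by ring.
  rewrite !kron_same, (kron_neq (j + 1 - 1)%Z) in h by lia.
  transitivity (b * (1 * (lambda + mu + IZR (j + 1)) + 0 * (mu - IZR (j + 1)))
    - T1_coef (j + 1) * (b * 1))%C; [ring |].
  rewrite h; [ring |]; intros phi t; apply coef_S1_zero; [apply coef_S1p |].
  apply coef_S1m_zero; intros i' hi'; apply IH2; lia.
Qed.

Lemma S1m_basis i : S1m (basis i) = zero.
Proof.
(* Since [wt_minus i < m + 1], this depth puts the threshold exactly at [wt_minus i]. *)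
apply (proj2 (S1m_descent (Z.to_nat (m + 1 - wt_minus i)))).
generalize (wt_minus_lt_plus i 0); unfold wt_plus; lia.
Qed.

Lemma S1_vanishes (x : H2) : S1 x = zero.
Proof.
apply l2_ext; intros p.
change (coef (S1 x) p = RtoC 0); apply coef_S1_zero; [apply coef_S1p |].
apply coef_S1m_zero; intros i _; apply S1m_basis.
Qed.
End Block.

Theorem theorem5p1 (lambda : R) (hlambda : -1 < lambda <= 1) (m k : Z)
    (hm : 0 < lambda + 2 * IZR m) (hk : 0 < 2 - lambda + 2 * IZR k)
    (c : continuous_series lambda) (hc : ~ is_P10 c)
    (pi1 : Mob -> series_space c -> series_space c)
    (hpi1 : is_R_rep lambda (series_mu c) pi1)
    (pip : Mob -> Hdisc (lambda + 2 * IZR m) hm -> Hdisc (lambda + 2 * IZR m) hm)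
    (hpip : is_Dplus_rep pip)
    (pim : Mob -> Hdisc (2 - lambda + 2 * IZR k) hk ->
           Hdisc (2 - lambda + 2 * IZR k) hk)
    (hpim : is_Dminus_rep pim)
    (H1 := series_space c)
    (H2 := hsum (Hdisc (lambda + 2 * IZR m) hm) (Hdisc (2 - lambda + 2 * IZR k) hk))
    (T1 : H1 -> H1) (S1 : H2 -> H1) (S2 : H1 -> H2) (T2 : H2 -> H2)
    (hT1 : is_linear T1) (hS1 : is_linear S1) (hS2 : is_linear S2)
    (hT2 : is_linear T2)
    (T := block_op T1 S1 S2 T2)
    (hT : homogeneous T)
    (hassoc : associated (rep_sum pi1 (rep_sum pip pim)) T) :
  forall x : H2, S1 x = zero.
Proof.
exact (S1_vanishes hpi1 hpip hpim hT1 hS1 hS2 hT2 hT hassoc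
  (series_mu_not_int c hc) (lambda_series_mu_not_int c hc)).
Qed.
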